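(* The reduction relation $\to_{EM}$ of $PPC_{EM}$ is confluent.
   Context: **Terms of $PPC_{EM}$.** Names $x,y,\dots$; $\theta$ ranges over finite lists of names. Terms: $$t ::= x \mid \hat{x} \mid t\,t \mid t\bullet t \mid [\theta]\,p\to b \mid b\langle\theta\vdash\mu\mid\Delta\rangle.$$ Here $x$ is a variable occurrence and $\hat x$ a matchable occurrence of a name. In a matching $b\langle\theta\vdash\mu\mid\Delta\rangle$, $\mu$ is a decided match, i.e. either $\bot$ or a substitution (a finite map from names to terms), and $\Delta$ is a finite multiset of pairs of terms. The notation $(a,p)\Delta$ is the multiset union of $\Delta$ with $\{(a,p)\}$. As a term, $\bot$ denotes a fixed closed normal term without $\bullet$ or matchings. **Binding and free names.** In $[\theta]p\to b$, $\theta$ binds matchables $\hat x$ ($x\in\theta$) in $p$ and variables $x\in\theta$ in $b$. In $b\langle\theta\vdash\mu\mid\Delta\rangle$, $\theta$ binds variables of $b$ and matchables in the second components of the pairs of $\Delta$. $\mathrm{fn}(a)$ is the set of free names of $a$. Terms are taken modulo $\alpha$-conversion, with all bound names distinct and disjoint from free names. **Substitution.** $t^\sigma$ is capture-avoiding replacement of free variables $x\in\mathrm{dom}(\sigma)$ by $\sigma(x)$, propagating into $\mathrm{codom}\,\mu$ and into $\Delta$. **Disjoint union $\uplus$ of decided matches.** It is commutative; $\bot\uplus\mu=\bot$; $\sigma_1\uplus\sigma_2=\bot$ if the domains overlap, and otherwise it is their union. **Failure pairs.** Call $(a,p)$ a *failure pair* (relative to $\theta$) if it is one of: - $(\hat y,\hat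 x)$ with $x\notin\theta$ and $x\ne y$; - $(a_1\bullet a_2,\hat x)$ with $x\notin\theta$; - $([\theta_a]p_a\to b_a,\hat x)$ with $x\notin\theta$; - $(\hat x,p_1\bullet p_2)$; - $([\theta_a]p_a\to b_a,p_1\bullet p_2)$; - $(a,[\theta_p]p_p\to b_p)$. **Rules of $PPC_{EM}$.** $\to_{EM}$ is the closure under all contexts (including inside $\mu$'s codomain and $\Delta$) of the following rules. - $([\theta]p\to b)a\to b\langle\theta\vdash\emptyset\mid(a,p)\rangle$. - $\hat x\,t\to\hat x\bullet t$. - $(t_1\bullet t_2)t_3\to(t_1\bullet t_2)\bullet t_3$. - $b\langle\theta\vdash\mu\mid(a,\hat x)\Delta\rangle\to b\langle\theta\vdash\mu\uplus\{x\mapsto a\}\mid\Delta\rangle$ if $x\in\theta$ and $\mathrm{fn}(a)\cap\theta=\emptyset$. - $b\langle\theta\vdash\mu\mid(\hat x,\hat x)\Delta\rangle\to b\langle\theta\vdash\mu\mid\Delta\rangle$ if $x\notin\theta$. - $b\langle\theta\vdash\mu\mid(a_1\bullet a_2,p_1\bullet p_2)\Delta\rangle\to b\langle\theta\vdash\mu\mid(a_1,p_1)(a_2,p_2)\Delta\rangle$. - $b\langle\theta\vdash\mu\mid(a,p)\Delta\rangle\to b\langle\theta\vdash\bot\mid\Delta\rangle$ for $(a,p)$ a failure pair. - $b\langle\theta\vdash\sigma\mid\emptyset\rangle\to b^\sigma$ if $\mathrm{dom}\,\sigma=\theta$ (as sets). - $b\langle\theta\vdash\sigma\mid\emptyset\rangle\to\bot$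 if $\mathrm{dom}\,\sigma\neq\theta$. - $b\langle\theta\vdash\bot\mid\Delta\rangle\to\bot$. *)

(* Defs.v *)
(* Syntax and reduction of PPC_EM (pure pattern calculus with
   explicit matching), terms taken modulo alpha-conversion (and modulo the
   multiset / finite-map identities of Delta and mu). *)
From Stdlib Require Import List Arith Permutation Relations.
Import ListNotations.

Definition name := nat.

(* t ::= x | ^x | t t | t • t | [θ] p -> b | b<θ ⊢ μ | Δ>
   μ : None = ⊥ ; Some s = substitution (finite map given as an association
   list, compared up to permutation, with distinct keys -- see [wf]).
   Δ : multiset of pairs, given as a list compared up to permutation. *)
Inductive term : Type :=
| Var (x : name)
| Mat (x : name)
| App (t u : term)
| Dat (t u : term)
| Abs (th : list name) (p b : term)
| Mtc (b : term) (th : list name) (mu : option (list (name * term)))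
      (D : list (term * term)).

Definition inb (z : name) (l : list name) : bool := existsb (Nat.eqb z) l.

Definition mu_codom (mu : option (list (name * term))) : list term :=
  match mu with None => [] | Some s => map snd s end.

Fixpoint fv (t : term) : list name :=
  match t with
  | Var x => [x]
  | Mat _ => []
  | App t u | Dat t u => fv t ++ fv u
  | Abs th p b => fv p ++ filter (fun z => negb (inb z th)) (fv b)
  | Mtc b th mu D =>
      filter (fun z => negb (inb z th)) (fv b)
      ++ (match mu with None => []
          | Some s => (fix go (s : list (name * term)) :=
                         match s with [] => [] | (_, a) :: s' => fv a ++ go s' end) s end)
      ++ (fix go (D : list (term * term)) :=
            match D with [] => [] | (a, p) :: D' => fv a ++ fv p ++ go D' end) D
  end.

Fixpoint fm (t : term) : list name :=
  match t with
  | Var _ => []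
  | Mat x => [x]
  | App t u | Dat t u => fm t ++ fm u
  | Abs th p b => filter (fun z => negb (inb z th)) (fm p) ++ fm b
  | Mtc b th mu D =>
      fm b
      ++ (match mu with None => []
          | Some s => (fix go (s : list (name * term)) :=
                         match s with [] => [] | (_, a) :: s' => fm a ++ go s' end) s end)
      ++ (fix go (D : list (term * term)) :=
            match D with [] => [] | (a, p) :: D' =>
              fm a ++ filter (fun z => negb (inb z th)) (fm p) ++ go D' end) D
  end.

Definition fn (t : term) : list name := fv t ++ fm t.

Fixpoint names (t : term) : list name :=
  match t with
  | Var x | Mat x => [x]
  | App t u | Dat t u => names t ++ names u
  | Abs th p b => th ++ names p ++ names b
  | Mtc b th mu D =>
      th ++ names b
      ++ (match mu with None => []
          | Some s => (fix go (s : list (name * term)) :=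
                         match s with [] => [] | (x, a) :: s' => x :: names a ++ go s' end) s end)
      ++ (fix go (D : list (term * term)) :=
            match D with [] => [] | (a, p) :: D' => names a ++ names p ++ go D' end) D
  end.

Fixpoint bnames (t : term) : list name :=
  match t with
  | Var _ | Mat _ => []
  | App t u | Dat t u => bnames t ++ bnames u
  | Abs th p b => th ++ bnames p ++ bnames b
  | Mtc b th mu D =>
      th ++ bnames b
      ++ (match mu with None => []
          | Some s => (fix go (s : list (name * term)) :=
                         match s with [] => [] | (_, a) :: s' => bnames a ++ go s' end) s end)
      ++ (fix go (D : list (term * term)) :=
            match D with [] => [] | (a, p) :: D' => bnames a ++ bnames p ++ go D' end) D
  end.

Definition rn (x y z : name) : name := if Nat.eqb z x then y else z.

Fixpoint ren_v (x y : name) (t : term) : term :=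
  match t with
  | Var z => Var (rn x y z)
  | Mat z => Mat z
  | App t u => App (ren_v x y t) (ren_v x y u)
  | Dat t u => Dat (ren_v x y t) (ren_v x y u)
  | Abs th p b => Abs th (ren_v x y p) (if inb x th then b else ren_v x y b)
  | Mtc b th mu D =>
      Mtc (if inb x th then b else ren_v x y b) th
        (match mu with None => None
         | Some s => Some ((fix go (s : list (name * term)) :=
                      match s with [] => [] | (z, a) :: s' => (z, ren_v x y a) :: go s' end) s) end)
        ((fix go (D : list (term * term)) :=
            match D with [] => [] | (a, p) :: D' => (ren_v x y a, ren_v x y p) :: go D' end) D)
  end.

Fixpoint ren_m (x y : name) (t : term) : term :=
  match t with
  | Var z => Var z
  | Mat z => Mat (rn x y z)
  | App t u => App (ren_m x y t) (ren_m x y u)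
  | Dat t u => Dat (ren_m x y t) (ren_m x y u)
  | Abs th p b => Abs th (if inb x th then p else ren_m x y p) (ren_m x y b)
  | Mtc b th mu D =>
      Mtc (ren_m x y b) th
        (match mu with None => None
         | Some s => Some ((fix go (s : list (name * term)) :=
                      match s with [] => [] | (z, a) :: s' => (z, ren_m x y a) :: go s' end) s) end)
        ((fix go (D : list (term * term)) :=
            match D with [] => [] | (a, p) :: D' =>
              (ren_m x y a, if inb x th then p else ren_m x y p) :: go D' end) D)
  end.

Inductive ctx (R : term -> term -> Prop) : term -> term -> Prop :=
| ctx_base t u : R t u -> ctx R t u
| ctx_app_l t t' u : ctx R t t' -> ctx R (App t u) (App t' u)
| ctx_app_r t u u' : ctx R u u' -> ctx R (App t u) (App t u')
| ctx_dat_l t t' u : ctx R t t' -> ctx R (Dat t u) (Dat t' u)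
| ctx_dat_r t u u' : ctx R u u' -> ctx R (Dat t u) (Dat t u')
| ctx_abs_p th p p' b : ctx R p p' -> ctx R (Abs th p b) (Abs th p' b)
| ctx_abs_b th p b b' : ctx R b b' -> ctx R (Abs th p b) (Abs th p b')
| ctx_mtc_b b b' th mu D : ctx R b b' -> ctx R (Mtc b th mu D) (Mtc b' th mu D)
| ctx_mtc_mu b th s1 x a a' s2 D : ctx R a a' ->
    ctx R (Mtc b th (Some (s1 ++ (x, a) :: s2)) D) (Mtc b th (Some (s1 ++ (x, a') :: s2)) D)
| ctx_mtc_D1 b th mu D1 a a' p D2 : ctx R a a' ->
    ctx R (Mtc b th mu (D1 ++ (a, p) :: D2)) (Mtc b th mu (D1 ++ (a', p) :: D2))
| ctx_mtc_D2 b th mu D1 a p p' D2 : ctx R p p' ->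
    ctx R (Mtc b th mu (D1 ++ (a, p) :: D2)) (Mtc b th mu (D1 ++ (a, p') :: D2)).

Inductive eq_base : term -> term -> Prop :=
| eq_alpha_abs th p b x y :
    In x th -> ~ In y (names (Abs th p b)) ->
    eq_base (Abs th p b) (Abs (map (rn x y) th) (ren_m x y p) (ren_v x y b))
| eq_alpha_mtc b th mu D x y :
    In x th -> ~ In y (names (Mtc b th mu D)) ->
    eq_base (Mtc b th mu D)
      (Mtc (ren_v x y b) (map (rn x y) th)
           (option_map (map (fun za => (rn x y (fst za), snd za))) mu)
           (map (fun ap => (fst ap, ren_m x y (snd ap))) D))
| eq_perm_D b th mu D D' : Permutation D D' -> eq_base (Mtc b th mu D) (Mtc b th mu D')
| eq_perm_mu b th s s' D : Permutation s s' ->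
    eq_base (Mtc b th (Some s) D) (Mtc b th (Some s') D).

Definition tequiv : term -> term -> Prop := clos_refl_sym_trans term (ctx eq_base).

Definition dunion (m1 m2 : option (list (name * term))) : option (list (name * term)) :=
  match m1, m2 with
  | Some s1, Some s2 =>
      if existsb (fun x => inb x (map fst s2)) (map fst s1) then None else Some (s1 ++ s2)
  | _, _ => None
  end.

Inductive failure (th : list name) : term -> term -> Prop :=
| fail_mm y x : ~ In x th -> x <> y -> failure th (Mat y) (Mat x)
| fail_dm a1 a2 x : ~ In x th -> failure th (Dat a1 a2) (Mat x)
| fail_am tha pa ba x : ~ In x th -> failure th (Abs tha pa ba) (Mat x)
| fail_md x p1 p2 : failure th (Mat x) (Dat p1 p2)
| fail_ad tha pa ba p1 p2 : failure th (Abs tha pa ba) (Dat p1 p2)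
| fail_abs a thp pp bp : failure th a (Abs thp pp bp).

(* substitution of free variables (naive; used only under the no-capture
   side condition in the reduction rule below) *)
Fixpoint lookup (x : name) (s : list (name * term)) : option term :=
  match s with [] => None | (z, a) :: s' => if Nat.eqb x z then Some a else lookup x s' end.

Definition restrict (th : list name) (s : list (name * term)) : list (name * term) :=
  filter (fun za => negb (inb (fst za) th)) s.

Fixpoint subst (s : list (name * term)) (t : term) : term :=
  match t with
  | Var x => match lookup x s with Some a => a | None => Var x end
  | Mat x => Mat x
  | App t u => App (subst s t) (subst s u)
  | Dat t u => Dat (subst s t) (subst s u)
  | Abs th p b => Abs th (subst s p) (subst (restrict th s) b)
  | Mtc b th mu D =>
      Mtc (subst (restrict th s) b) th
        (match mu with None => None
         | Some s0 => Some ((fix go (s0 : list (name * term)) :=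
                      match s0 with [] => [] | (z, a) :: s' => (z, subst s a) :: go s' end) s0) end)
        ((fix go (D : list (term * term)) :=
            match D with [] => [] | (a, p) :: D' => (subst s a, subst s p) :: go D' end) D)
  end.

Definition same_set (l1 l2 : list name) : Prop := forall z, In z l1 <-> In z l2.

Inductive rule (bot : term) : term -> term -> Prop :=
| r_beta th p b a :
    rule bot (App (Abs th p b) a) (Mtc b th (Some []) [(a, p)])
| r_mat x t : rule bot (App (Mat x) t) (Dat (Mat x) t)
| r_dat t1 t2 t3 : rule bot (App (Dat t1 t2) t3) (Dat (Dat t1 t2) t3)
| r_bind b th mu a x D :
    In x th -> (forall z, In z (fn a) -> ~ In z th) ->
    rule bot (Mtc b th mu ((a, Mat x) :: D)) (Mtc b th (dunion mu (Some [(x, a)])) D)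
| r_same b th mu x D :
    ~ In x th -> rule bot (Mtc b th mu ((Mat x, Mat x) :: D)) (Mtc b th mu D)
| r_split b th mu a1 a2 p1 p2 D :
    rule bot (Mtc b th mu ((Dat a1 a2, Dat p1 p2) :: D))
             (Mtc b th mu ((a1, p1) :: (a2, p2) :: D))
| r_fail b th mu a p D :
    failure th a p -> rule bot (Mtc b th mu ((a, p) :: D)) (Mtc b th None D)
| r_subst b th s :
    same_set (map fst s) th ->
    (forall z, In z (bnames b) -> ~ In z (flat_map fn (map snd s))) ->
    rule bot (Mtc b th (Some s) []) (subst s b)
| r_dom b th s :
    ~ same_set (map fst s) th -> rule bot (Mtc b th (Some s) []) bot
| r_bot b th D : rule bot (Mtc b th None D) bot.

Definition step (bot : term) (t u : term) : Prop :=
  exists t' u', tequiv t t' /\ ctx (rule bot) t' u' /\ tequiv u' u.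

Definition steps (bot : term) : term -> term -> Prop := clos_refl_trans term (step bot).

Fixpoint wf (t : term) : Prop :=
  match t with
  | Var _ | Mat _ => True
  | App t u | Dat t u => wf t /\ wf u
  | Abs _ p b => wf p /\ wf b
  | Mtc b _ mu D =>
      wf b
      /\ (match mu with None => True
          | Some s => NoDup (map fst s) /\
              (fix go (s : list (name * term)) :=
                 match s with [] => True | (_, a) :: s' => wf a /\ go s' end) s end)
      /\ (fix go (D : list (term * term)) :=
            match D with [] => True | (a, p) :: D' => wf a /\ wf p /\ go D' end) D
  end.

Fixpoint pure (t : term) : Prop :=
  match t with
  | Var _ | Mat _ => True
  | App t u => pure t /\ pure u
  | Dat _ _ => False
  | Abs _ p b => pure p /\ pure b
  | Mtc _ _ _ _ => False
  end.

Definition bot_ok (bot : term) : Prop :=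
  fn bot = [] /\ pure bot /\ (forall u, ~ step bot bot u).

(* Main.v *)
Require Import Defs.
From Stdlib Require Import List Relations.
From Stdlib Require Import Arith Lia Bool Permutation FunctionalExtensionality ListDec.
From Stdlib Require FinFun.
Import ListNotations.

(* Modulo alpha-conversion and the order of Delta the calculus is almost orthogonal. This becomes literal in a
   de Bruijn calculus where a matching carries a binary tree of its pairs: a pair is replaced in place by a
   binding, a success, a failure or two pairs, so that neither permutations nor the disjoint union of decided
   matches occur in the rules. The only overlap left is a failing matching, which reduces to bottom whatever
   its subterms do. Parallel reduction of these trees has complete developments, hence is confluent.
   A relation "the tree d represents the named term t" carries reduction sequences from named terms to trees
   and back, it is invariant under [tequiv], and two named terms represented by the same tree are [tequiv]. *)

(** * Match trees in de Bruijn form *)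

(** Working on named terms directly meets an obstacle: [mu] forgets its bindings once it becomes
    bottom, so two orders of resolving the pairs agree only through bookkeeping that the rules do
    not record. In a tree a resolved pair keeps its place and its binding. Failure is a property of
    the whole tree, [failing], which reduction never destroys and which is consulted only when the
    matching is contracted. Variables and matchables have separate index spaces, since a binder list
    binds the former in a body and the latter in a pattern. Each [TPend] stores the number of
    matchables that it binds in its pattern, so a pair reduces without knowledge of the matching
    around it. The list [c] codes a binder list by positions of first occurrences. It records
    repeated names, which the comparison of a domain with the binder list has to see, and it
    determines the binder list up to the choice of names. Bottom becomes a parameter [bt] that is
    invariant under substitution. *)

Inductive tm : Type :=
| TV (i : nat)
| TM (i : nat)
| TApp (t u : tm)
| TDat (t u : tm)
| TAbs (c : list nat) (p b : tm)
| TMtc (c : list nat) (b m : tm)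
| TPend (n : nat) (a p : tm)
| TBnd (k : nat) (a : tm)
| TOk
| TFail
| TNode (m1 m2 : tm).

(** * Renaming and substitution of indices *)

Definition up (n : nat) (r : nat -> nat) (i : nat) : nat :=
  if i <? n then i else n + r (i - n).

Fixpoint ren (r q : nat -> nat) (t : tm) : tm :=
  match t with
  | TV i => TV (r i)
  | TM i => TM (q i)
  | TApp t u => TApp (ren r q t) (ren r q u)
  | TDat t u => TDat (ren r q t) (ren r q u)
  | TAbs c p b => TAbs c (ren r (up (length c) q) p) (ren (up (length c) r) q b)
  | TMtc c b m => TMtc c (ren (up (length c) r) q b) (ren r q m)
  | TPend n a p => TPend n (ren r q a) (ren r (up n q) p)
  | TBnd k a => TBnd k (ren r q a)
  | TOk => TOk
  | TFail => TFail
  | TNode m1 m2 => TNode (ren r q m1) (ren r q m2)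
  end.

Definition upv (n : nat) (s : nat -> tm) (i : nat) : tm :=
  if i <? n then TV i else ren (Nat.add n) id (s (i - n)).

(** A pattern binds matchables only, so the indices of the substituted variables stay and just the
    free matchables of the images are shifted. *)
Definition upm (n : nat) (s : nat -> tm) (i : nat) : tm := ren id (Nat.add n) (s i).

(** Matchables are never replaced by terms, only renamed. Carrying the renaming [q] along makes
    [ren] an instance of [sub]. *)
Fixpoint sub (s : nat -> tm) (q : nat -> nat) (t : tm) : tm :=
  match t with
  | TV i => s i
  | TM i => TM (q i)
  | TApp t u => TApp (sub s q t) (sub s q u)
  | TDat t u => TDat (sub s q t) (sub s q u)
  | TAbs c p b => TAbs c (sub (upm (length c) s) (up (length c) q) p) (sub (upv (length c) s) q b)
  | TMtc c b m => TMtc c (sub (upv (length c) s) q b) (sub s q m)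
  | TPend n a p => TPend n (sub s q a) (sub (upm n s) (up n q) p)
  | TBnd k a => TBnd k (sub s q a)
  | TOk => TOk
  | TFail => TFail
  | TNode m1 m2 => TNode (sub s q m1) (sub s q m2)
  end.

Ltac ltb := repeat (match goal with
  | |- context [?a <? ?b] => destruct (Nat.ltb_spec a b)
  | H : context [?a <? ?b] |- _ => destruct (Nat.ltb_spec a b)
  end).

Lemma up_add n r i : up n r (n + i) = n + r i.
Proof. unfold up. ltb; [lia|]. repeat f_equal. lia. Qed.

Lemma up_lt n r i : i < n -> up n r i = i.
Proof. unfold up. intros. ltb; lia. Qed.

Lemma upv_add n s i : upv n s (n + i) = ren (Nat.add n) id (s i).
Proof. unfold upv. ltb; [lia|]. repeat f_equal. lia. Qed.

Lemma upv_lt n s i : i < n -> upv n s i = TV i.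
Proof. unfold upv. intros. ltb; [reflexivity|lia]. Qed.

Lemma lt_or_add n i : i < n \/ exists j, i = n + j.
Proof. destruct (le_lt_dec n i); [right; exists (i - n)|left]; lia. Qed.

Ltac split_at n i := let j := fresh "j" in let H := fresh "L" in destruct (lt_or_add n i) as [H|[j ->]];
  [ rewrite ?(fun r => up_lt n r i H), ?(fun s => upv_lt n s i H) | rewrite ?up_add, ?upv_add ].

Lemma up_comp n r r' : (fun i => up n r (up n r' i)) = up n (fun i => r (r' i)).
Proof. extensionality i. split_at n i; auto. Qed.

Lemma up_id n : up n id = id.
Proof. extensionality i. split_at n i; auto. Qed.

Lemma up_inj n r : (forall i j, r i = r j -> i = j) -> forall i j, up n r i = up n r j -> i = j.
Proof.
  intros H i j. split_at n i; split_at n j; try lia. intros E. f_equal. apply H. lia.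
Qed.

Lemma ren_ren t : forall r q r' q',
  ren r q (ren r' q' t) = ren (fun i => r (r' i)) (fun i => q (q' i)) t.
Proof.
  induction t; intros; simpl; f_equal; rewrite ?IHt, ?IHt1, ?IHt2, ?up_comp; reflexivity.
Qed.

Lemma sub_ren t : forall s q r q',
  sub s q (ren r q' t) = sub (fun i => s (r i)) (fun i => q (q' i)) t.
Proof.
  assert (Hv : forall n s r, (fun i => upv n s (up n r i)) = upv n (fun i => s (r i))).
  { intros. extensionality i. split_at n i; auto. }
  induction t; intros; simpl; f_equal; rewrite ?IHt, ?IHt1, ?IHt2, ?up_comp, ?Hv; reflexivity.
Qed.

Lemma ren_sub t : forall r q s q',
  ren r q (sub s q' t) = sub (fun i => ren r q (s i)) (fun i => q (q' i)) t.
Proof.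
  assert (Hv : forall n r q s, (fun i => ren (up n r) q (upv n s i)) = upv n (fun i => ren r q (s i))).
  { intros. extensionality i. split_at n i; simpl.
    - now rewrite up_lt.
    - rewrite !ren_ren. f_equal. extensionality k. apply up_add. }
  assert (Hm : forall n r q s, (fun i => ren r (up n q) (upm n s i)) = upm n (fun i => ren r q (s i))).
  { intros. extensionality i. unfold upm. rewrite !ren_ren. f_equal. extensionality k. apply up_add. }
  induction t; intros; simpl; f_equal; rewrite ?IHt, ?IHt1, ?IHt2, ?up_comp, ?Hv, ?Hm; reflexivity.
Qed.

(** Lifting a substitution renames its images, so the two facts on lifting rest on both mixed laws,
    [sub_ren] and [ren_sub]. *)
Lemma sub_sub t : forall s q s' q',
  sub s q (sub s' q' t) = sub (fun i => sub s q (s' i)) (fun i => q (q' i)) t.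
Proof.
  assert (Hv : forall n s q s', (fun i => sub (upv n s) q (upv n s' i)) = upv n (fun i => sub s q (s' i))).
  { intros. extensionality i. split_at n i; simpl.
    - now rewrite upv_lt.
    - rewrite sub_ren, ren_sub. f_equal. extensionality k. apply upv_add. }
  assert (Hm : forall n s q s', (fun i => sub (upm n s) (up n q) (upm n s' i)) = upm n (fun i => sub s q (s' i))).
  { intros. extensionality i. unfold upm. rewrite sub_ren, ren_sub. f_equal. extensionality k. apply up_add. }
  induction t; intros; simpl; f_equal; rewrite ?IHt, ?IHt1, ?IHt2, ?up_comp, ?Hv, ?Hm; reflexivity.
Qed.

Lemma sub_id t : sub TV id t = t.
Proof.
  assert (Hv : forall n, upv n TV = TV).
  { intros. extensionality i. split_at n i; reflexivity. }
  assert (Hm : forall n, upm n TV = TV) by reflexivity.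
  induction t; simpl; rewrite ?Hv, ?Hm, ?up_id; f_equal; auto.
Qed.

(* [pend], [binds] and [fl] read Delta, the bindings of mu and the presence of a failure off a match tree;
   [wsm] tells match trees from other terms, which share the type [tm]. *)

Fixpoint wsm (m : tm) : bool :=
  match m with
  | TPend _ _ _ | TBnd _ _ | TOk | TFail => true
  | TNode m1 m2 => wsm m1 && wsm m2
  | _ => false
  end.

Fixpoint pend (m : tm) : list (nat * tm * tm) :=
  match m with
  | TPend n a p => [(n, a, p)]
  | TNode m1 m2 => pend m1 ++ pend m2
  | _ => []
  end.

Fixpoint binds (m : tm) : list (nat * tm) :=
  match m with
  | TBnd k a => [(k, a)]
  | TNode m1 m2 => binds m1 ++ binds m2
  | _ => []
  end.

Fixpoint fl (m : tm) : bool :=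
  match m with
  | TFail => true
  | TNode m1 m2 => fl m1 || fl m2
  | _ => false
  end.

Definition keys (m : tm) : list nat := map fst (binds m).

(** These are the two ways in which the disjoint union of everything decided in the tree can be
    bottom. A clash of keys is thus seen globally and not at the moment a binding is produced. *)
Definition failing (m : tm) : Prop := fl m = true \/ ~ NoDup (keys m).

Fixpoint look (k : nat) (S : list (nat * tm)) : tm :=
  match S with [] => TOk | (j, a) :: S' => if Nat.eqb k j then a else look k S' end.

(* [look] and [inst] return the junk value [TOk] for positions that carry no binding; it is closed, as required
   by [inst_sub]. *)
Definition inst (n : nat) (S : list (nat * tm)) (i : nat) : tm :=
  if i <? n then look i S else TV (i - n).

(** The argument [a] lies outside the [n] matchables bound in [p], so its matchable [i] appears in
    [p] as [n + i]. *)
Definition failb (n : nat) (a p : tm) : bool :=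
  match p with
  | TM k => (n <=? k) && match a with
                         | TM i => negb (k =? n + i)
                         | TDat _ _ | TAbs _ _ _ => true
                         | _ => false
                         end
  | TDat _ _ => match a with TM _ | TAbs _ _ _ => true | _ => false end
  | TAbs _ _ _ => true
  | _ => false
  end.

(** Substitution could put a match tree in the place of a variable; the hypothesis excludes
    variables at the positions that are read. A renaming cannot do this, whence the unconditional
    [wsm_ren]. *)
Lemma wsm_sub s q m : wsm m = true ->
  wsm (sub s q m) = true /\ fl (sub s q m) = fl m /\
  binds (sub s q m) = map (fun ka => (fst ka, sub s q (snd ka))) (binds m) /\
  pend (sub s q m) = map (fun x => (fst (fst x), sub s q (snd (fst x)),
                                    sub (upm (fst (fst x)) s) (up (fst (fst x)) q) (snd x))) (pend m).
Proof.
  induction m; simpl; intros H; try discriminate; auto.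
  apply andb_prop in H as [H1 H2].
  destruct (IHm1 H1) as (-> & -> & -> & ->), (IHm2 H2) as (-> & -> & -> & ->).
  now rewrite !map_app.
Qed.

Lemma wsm_ren r q m :
  wsm (ren r q m) = wsm m /\ fl (ren r q m) = fl m /\
  binds (ren r q m) = map (fun ka => (fst ka, ren r q (snd ka))) (binds m) /\
  pend (ren r q m) = map (fun x => (fst (fst x), ren r q (snd (fst x)),
                                    ren r (up (fst (fst x)) q) (snd x))) (pend m).
Proof.
  induction m; simpl; auto.
  destruct IHm1 as (-> & -> & -> & ->), IHm2 as (-> & -> & -> & ->).
  now rewrite !map_app.
Qed.

Lemma map_fst_snd_map {A B C} (h : B -> C) (l : list (A * B)) :
  map fst (map (fun x => (fst x, h (snd x))) l) = map fst l.
Proof. now rewrite map_map. Qed.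

(** Below [n] both sides read the same entry of [S]; from [n] on, the shift made by [upv] is undone
    by the instantiation. *)
Lemma inst_sub n S s q b :
  sub s q (sub (inst n S) id b)
  = sub (inst n (map (fun ka => (fst ka, sub s q (snd ka))) S)) id (sub (upv n s) q b).
Proof.
  rewrite !sub_sub. f_equal. extensionality i. unfold inst at 1.
  split_at n i; simpl.
  - destruct (Nat.ltb_spec i n); [|lia]. unfold inst. destruct (Nat.ltb_spec i n); [|lia].
    induction S as [|[j a] S IH]; simpl; auto. now destruct (i =? j).
  - destruct (Nat.ltb_spec (n + j) n); [lia|]. simpl.
    rewrite sub_ren. replace (fun i => inst n _ (n + i)) with TV.
    + replace (n + j - n) with j by lia. symmetry. apply sub_id.
    + extensionality k. unfold inst. destruct (Nat.ltb_spec (n + k) n); [lia|]. f_equal. lia.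
Qed.

Lemma ren_as_sub t : forall r q, ren r q t = sub (fun i => TV (r i)) q t.
Proof.
  intros. rewrite <- (sub_id (ren r q t)). rewrite sub_ren. reflexivity.
Qed.

Lemma inst_ren n S r q b :
  ren r q (sub (inst n S) id b)
  = sub (inst n (map (fun ka => (fst ka, ren r q (snd ka))) S)) id (ren (up n r) q b).
Proof.
  rewrite ren_as_sub, inst_sub. f_equal.
  - f_equal. apply map_ext. intros. now rewrite ren_as_sub.
  - rewrite ren_as_sub. f_equal. extensionality i. split_at n i; auto.
Qed.

(** * Parallel reduction, complete developments and confluence on trees *)

Section Par.
Variable bt : tm.
Hypothesis bt_closed : forall s q, sub s q bt = bt.

(** The side conditions of the contractions of a matching are tested on the source tree [m], while
    the contractum of [p_sub] reads the bindings of its reduct [m']. Subterms that a rule discards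
    carry no premise. Pairs may still be pending in [p_bot]. *)
Inductive par : tm -> tm -> Prop :=
| p_v i : par (TV i) (TV i)
| p_m i : par (TM i) (TM i)
| p_app t t' u u' : par t t' -> par u u' -> par (TApp t u) (TApp t' u')
| p_dat t t' u u' : par t t' -> par u u' -> par (TDat t u) (TDat t' u')
| p_abs c p p' b b' : par p p' -> par b b' -> par (TAbs c p b) (TAbs c p' b')
| p_mtc c b b' m m' : par b b' -> par m m' -> par (TMtc c b m) (TMtc c b' m')
| p_pend n a a' p p' : par a a' -> par p p' -> par (TPend n a p) (TPend n a' p')
| p_bnd k a a' : par a a' -> par (TBnd k a) (TBnd k a')
| p_ok : par TOk TOk
| p_fl : par TFail TFail
| p_node m1 m1' m2 m2' : par m1 m1' -> par m2 m2' -> par (TNode m1 m2) (TNode m1' m2')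
| p_beta c p p' b b' a a' : par p p' -> par b b' -> par a a' ->
    par (TApp (TAbs c p b) a) (TMtc c b' (TPend (length c) a' p'))
| p_mat i t t' : par t t' -> par (TApp (TM i) t) (TDat (TM i) t')
| p_dapp t1 t1' t2 t2' t3 t3' : par t1 t1' -> par t2 t2' -> par t3 t3' ->
    par (TApp (TDat t1 t2) t3) (TDat (TDat t1' t2') t3')
| p_bind n k a a' : k < n -> par a a' -> par (TPend n a (TM k)) (TBnd k a')
| p_same n i : par (TPend n (TM i) (TM (n + i))) TOk
| p_split n a1 a1' a2 a2' p1 p1' p2 p2' :
    par a1 a1' -> par a2 a2' -> par p1 p1' -> par p2 p2' ->
    par (TPend n (TDat a1 a2) (TDat p1 p2)) (TNode (TPend n a1' p1') (TPend n a2' p2'))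
| p_fail n a p : failb n a p = true -> par (TPend n a p) TFail
| p_sub c b b' m m' : wsm m = true -> pend m = [] -> ~ failing m -> same_set (keys m) c ->
    par b b' -> par m m' -> par (TMtc c b m) (sub (inst (length c) (binds m')) id b')
| p_dom c b m : wsm m = true -> pend m = [] -> ~ failing m -> ~ same_set (keys m) c ->
    par (TMtc c b m) bt
| p_bot c b m : wsm m = true -> failing m -> par (TMtc c b m) bt.

Lemma par_refl t : par t t.
Proof. induction t; constructor; auto. Qed.

Lemma bt_ren r q : ren r q bt = bt.
Proof. rewrite ren_as_sub. apply bt_closed. Qed.

(** Two distinct matchables have to stay distinct, otherwise a failing pair could turn into a
    success. This is why renaming and substitution in [par] ask for an injective [q]. *)
Lemma failb_ren n a p r q : (forall i j, q i = q j -> i = j) ->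
  failb n a p = true -> failb n (ren r q a) (ren r (up n q) p) = true.
Proof.
  intros Hq. destruct p; simpl; auto.
  - split_at n i.
    + destruct (Nat.leb_spec n i); simpl; [lia|discriminate].
    + destruct (Nat.leb_spec n (n + j)); simpl; [|lia].
      destruct (Nat.leb_spec n (n + q j)); simpl; [|lia].
      destruct a; simpl; auto.
      destruct (Nat.eqb_spec (n + j) (n + i)); simpl; [discriminate|].
      destruct (Nat.eqb_spec (n + q j) (n + q i)) as [E|]; simpl; auto.
      assert (j = i) by (apply Hq; lia). lia.
  - destruct a; simpl; auto.
Qed.

(** A positive test never depends on a variable in head position, so on such pairs substitution acts
    on the inspected constructors as a renaming of matchables does. *)
Lemma failb_sub n a p s q : (forall i j, q i = q j -> i = j) ->
  failb n a p = true -> failb n (sub s q a) (sub (upm n s) (up n q) p) = true.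
Proof.
  intros Hq H. pose proof (failb_ren n a p id q Hq H) as H'. revert H H'.
  destruct p; try discriminate; destruct a; simpl; auto;
    destruct (n <=? i); simpl; auto; discriminate.
Qed.

Lemma failing_map m m' : fl m' = fl m -> keys m' = keys m -> failing m' <-> failing m.
Proof. unfold failing. now intros -> ->. Qed.

Lemma par_ren t t' : par t t' -> forall r q, (forall i j, q i = q j -> i = j) ->
  par (ren r q t) (ren r q t').
Proof.
  induction 1; intros r q Hq; simpl; try (constructor; eauto using up_inj; fail).
  - rewrite up_lt by auto. constructor; auto.
  - rewrite up_add. constructor.
  - apply p_fail. now apply failb_ren.
  - rewrite inst_ren. destruct (wsm_ren r q m) as (E1 & E2 & E3 & E4).
    destruct (wsm_ren r q m') as (_ & _ & <- & _).
    assert (Ek : keys (ren r q m) = keys m) by (unfold keys; rewrite E3; apply map_fst_snd_map).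
    apply p_sub; auto.
    + congruence.
    + now rewrite E4, H0.
    + rewrite failing_map; eauto.
    + now rewrite Ek.
  - rewrite bt_ren. destruct (wsm_ren r q m) as (E1 & E2 & E3 & E4).
    assert (Ek : keys (ren r q m) = keys m) by (unfold keys; rewrite E3; apply map_fst_snd_map).
    apply p_dom; auto.
    + congruence.
    + now rewrite E4, H0.
    + rewrite failing_map; eauto.
    + now rewrite Ek.
  - rewrite bt_ren. destruct (wsm_ren r q m) as (E1 & E2 & E3 & E4).
    assert (Ek : keys (ren r q m) = keys m) by (unfold keys; rewrite E3; apply map_fst_snd_map).
    apply p_bot; auto.
    + congruence.
    + rewrite failing_map; eauto.
Qed.

(** Stability of the side conditions under reduction inside a match tree: failures are not erased,
    keys are only added, and once no pair is pending the tree can change only within its bound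
    terms. *)
Lemma par_wsm m m' : par m m' -> wsm m = true ->
  wsm m' = true /\ (fl m = true -> fl m' = true)
  /\ (exists l, Permutation (keys m') (keys m ++ l))
  /\ (pend m = [] -> pend m' = [] /\ fl m' = fl m /\
        Forall2 (fun x y => fst x = fst y /\ par (snd x) (snd y)) (binds m) (binds m')).
Proof.
  unfold keys.
  induction 1; simpl; intros W; try discriminate; repeat split; auto;
    try discriminate; try (now exists []); try (now eexists).
  - apply andb_prop in W as [W1 W2]. apply andb_true_intro.
    split; [now apply IHpar1 | now apply IHpar2].
  - apply andb_prop in W as [W1 W2]. intros F. apply orb_prop in F. apply orb_true_intro.
    destruct F; [left; now apply IHpar1 | right; now apply IHpar2].
  - apply andb_prop in W as [W1 W2].
    destruct (IHpar1 W1) as (_ & _ & (l1 & P1) & _), (IHpar2 W2) as (_ & _ & (l2 & P2) & _).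
    exists (l1 ++ l2). rewrite !map_app, P1, P2, <- !app_assoc.
    apply Permutation_app_head. rewrite !app_assoc. apply Permutation_app_tail, Permutation_app_comm.
  - apply andb_prop in W as [W1 W2]. apply app_eq_nil in H1 as [P1 P2].
    destruct (IHpar1 W1) as (_ & _ & _ & H1). destruct (IHpar2 W2) as (_ & _ & _ & H2).
    destruct (H1 P1) as (-> & _), (H2 P2) as (-> & _). auto.
  - apply andb_prop in W as [W1 W2]. apply app_eq_nil in H1 as [P1 P2].
    destruct (IHpar1 W1) as (_ & _ & _ & H1). destruct (IHpar2 W2) as (_ & _ & _ & H2).
    destruct (H1 P1) as (_ & -> & _), (H2 P2) as (_ & -> & _). auto.
  - apply andb_prop in W as [W1 W2]. apply app_eq_nil in H1 as [P1 P2].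
    destruct (IHpar1 W1) as (_ & _ & _ & H1). destruct (IHpar2 W2) as (_ & _ & _ & H2).
    destruct (H1 P1) as (_ & _ & F1), (H2 P2) as (_ & _ & F2). now apply Forall2_app.
Qed.

Lemma failing_par m m' : par m m' -> wsm m = true -> failing m -> failing m'.
Proof.
  intros P W. destruct (par_wsm _ _ P W) as (_ & F & (l & K) & _). intros [H|H]; [left; auto|right].
  intros N. apply H. apply (Permutation_NoDup K) in N. eapply NoDup_app_remove_r; eauto.
Qed.

Lemma Forall2_keys (R : tm -> tm -> Prop) S S' :
  Forall2 (fun x y => fst x = fst y /\ R (snd x) (snd y)) S S' -> map fst S = map (@fst nat tm) S'.
Proof. induction 1; simpl; f_equal; tauto. Qed.

Lemma par_inst n S S' :
  Forall2 (fun x y => fst x = fst y /\ par (snd x) (snd y)) S S' ->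
  forall i, par (inst n S i) (inst n S' i).
Proof.
  intros H i. unfold inst. destruct (i <? n); [|constructor].
  induction H as [|[k a] [k' a'] S S' [E P] H IH]; simpl in *; [constructor|].
  subst k'. destruct (i =? k); auto.
Qed.

Lemma par_subst t t' : par t t' -> forall s s' q,
  (forall i, par (s i) (s' i)) -> (forall i j, q i = q j -> i = j) ->
  par (sub s q t) (sub s' q t').
Proof.
  assert (Hv : forall s s' n, (forall i, par (s i) (s' i)) -> forall i, par (upv n s i) (upv n s' i)).
  { intros s s' n H i. split_at n i; [constructor|]. apply par_ren; auto. }
  assert (Hm : forall s s' n, (forall i, par (s i) (s' i)) -> forall i, par (upm n s i) (upm n s' i)).
  { intros s s' n H i. apply par_ren; auto. intros; lia. }
  induction 1; intros s s' q Hs Hq; simpl; auto; try (constructor; eauto using up_inj; fail).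
  - rewrite up_lt by auto. constructor; auto.
  - rewrite up_add. constructor.
  - apply p_fail. now apply failb_sub.
  - rewrite inst_sub. destruct (wsm_sub s q m H) as (E1 & E2 & E3 & E4).
    destruct (par_wsm _ _ H4 H) as (W' & _).
    destruct (wsm_sub s' q m' W') as (_ & _ & <- & _).
    assert (Ek : keys (sub s q m) = keys m) by (unfold keys; rewrite E3; apply map_fst_snd_map).
    apply p_sub; auto.
    + now rewrite E4, H0.
    + rewrite failing_map; eauto.
    + now rewrite Ek.
  - rewrite bt_closed. destruct (wsm_sub s q m H) as (E1 & E2 & E3 & E4).
    assert (Ek : keys (sub s q m) = keys m) by (unfold keys; rewrite E3; apply map_fst_snd_map).
    apply p_dom; auto.
    + now rewrite E4, H0.
    + rewrite failing_map; eauto.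
    + now rewrite Ek.
  - rewrite bt_closed. destruct (wsm_sub s q m H) as (E1 & E2 & E3 & E4).
    assert (Ek : keys (sub s q m) = keys m) by (unfold keys; rewrite E3; apply map_fst_snd_map).
    apply p_bot; auto. rewrite failing_map; eauto.
Qed.

Lemma failing_dec m : {failing m} + {~ failing m}.
Proof.
  unfold failing. destruct (fl m); [left; auto|].
  destruct (NoDup_dec Nat.eq_dec (keys m)); [right|left; auto].
  intros [E|E]; [discriminate|auto].
Defined.

Lemma same_set_dec l1 l2 : {same_set l1 l2} + {~ same_set l1 l2}.
Proof.
  destruct (incl_dec Nat.eq_dec l1 l2) as [H1|H1]; [destruct (incl_dec Nat.eq_dec l2 l1) as [H2|H2]|].
  - left. intros z. split; auto.
  - right. intros E. apply H2. intros z. apply E.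
  - right. intros E. apply H1. intros z. apply E.
Defined.

(** The redex is recognised on the undeveloped function [t] and built from its development [t'], so
    a redex created by the development itself is not contracted. *)
Definition dev_app (t t' u' : tm) : tm :=
  match t, t' with
  | TAbs c _ _, TAbs _ p b => TMtc c b (TPend (length c) u' p)
  | TM _, _ | TDat _ _, _ => TDat t' u'
  | _, _ => TApp t' u'
  end.

(* [a'] and [p'] are the complete developments of [a] and [p]. *)
Definition dev_pend (n : nat) (a p a' p' : tm) : tm :=
  if failb n a p then TFail else
  match p with
  | TM k => if k <? n then TBnd k a'
            else match a with TM _ => TOk | _ => TPend n a' p' end
  | TDat _ _ =>
      match a, a', p' with
      | TDat _ _, TDat a1 a2, TDat p1 p2 => TNode (TPend n a1 p1) (TPend n a2 p2)
      | _, _, _ => TPend n a' p'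
      end
  | _ => TPend n a' p'
  end.

(** A failing matching goes to [bt] at once, whatever its subterms are. This settles the overlap,
    because every reduct of that matching is either [bt] or again a failing matching. *)
Fixpoint dev (t : tm) : tm :=
  match t with
  | TV i => TV i
  | TM i => TM i
  | TApp t u =>
      dev_app t (dev t) (dev u)
  | TDat t u => TDat (dev t) (dev u)
  | TAbs c p b => TAbs c (dev p) (dev b)
  | TMtc c b m =>
      if wsm m then
        if failing_dec m then bt
        else match pend m with
             | [] => if same_set_dec (keys m) c
                     then sub (inst (length c) (binds (dev m))) id (dev b) else bt
             | _ => TMtc c (dev b) (dev m)
             end
      else TMtc c (dev b) (dev m)
  | TPend n a p => dev_pend n a p (dev a) (dev p)
  | TBnd k a => TBnd k (dev a)
  | TOk => TOk
  | TFail => TFail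
  | TNode m1 m2 => TNode (dev m1) (dev m2)
  end.

(** No parallel step changes a head that is a matchable, a data structure or an abstraction, and
    these are the heads that a positive test relies on. *)
Lemma failb_par n a p a' p' : par a a' -> par p p' -> failb n a p = true -> failb n a' p' = true.
Proof.
  intros Ha Hp. destruct p; try discriminate; inversion Hp; subst; simpl; auto;
    destruct a; inversion Ha; subst; simpl; auto; try (now destruct (n <=? _)); discriminate.
Qed.

Lemma par_dev_pend n a a' p p' :
  par a a' -> par p p' -> par a' (dev a) -> par p' (dev p) ->
  par (TPend n a' p') (dev_pend n a p (dev a) (dev p)).
Proof.
  intros Ha Hp Ha' Hp'. unfold dev_pend. destruct (failb n a p) eqn:F.
  { apply p_fail. eapply failb_par; eauto. }
  destruct p; try (constructor; assumption); try discriminate F.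
  - destruct (Nat.ltb_spec i n).
    + inversion Hp; subst. apply p_bind; auto.
    + destruct a; try (constructor; assumption). inversion Ha; inversion Hp; subst.
      (* Two matchables of which the pattern one is not bound here, and which do not fail, must be
         the same one. *)
      revert F. simpl. destruct (Nat.leb_spec n i); [|lia]. simpl.
      destruct (Nat.eqb_spec i (n + i0)); [|discriminate]. subst. constructor.
  - destruct a; try discriminate F; try (constructor; assumption).
    inversion Ha; subst; inversion Hp; subst. simpl in *.
    inversion Ha'; subst; inversion Hp'; subst. constructor; auto.
Qed.

(** The triangle property: whatever redexes of [t] were contracted, the remaining ones can still be
    contracted in one parallel step. The result does not depend on [t'], which gives the diamond. *)
Lemma par_dev t t' : par t t' -> par t' (dev t).
Proof.
  induction 1; try (simpl; constructor; auto; fail).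
  - simpl. destruct t; inversion H; subst; simpl in *; try (constructor; auto; fail).
    + inversion IHpar1; subst. constructor; auto.
    + inversion IHpar1; subst. constructor; auto.
  - simpl. destruct (wsm m) eqn:W; [|constructor; auto].
    pose proof (par_wsm _ _ H0 W) as (W' & _ & _ & Hp).
    destruct (failing_dec m) as [F|F].
    { apply p_bot; auto. eapply failing_par; eauto. }
    destruct (pend m) eqn:P; [|constructor; auto].
    destruct (Hp eq_refl) as (P' & F' & B'). apply Forall2_keys in B'.
    assert (Ek : keys m' = keys m) by (symmetry; apply B').
    destruct (same_set_dec (keys m) c) as [S|S].
    + apply p_sub; auto; [now rewrite (failing_map m) | now rewrite Ek].
    + apply p_dom; auto; [now rewrite (failing_map m) | now rewrite Ek].
  - simpl. apply par_dev_pend; auto.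
  - simpl. repeat (constructor; auto).
  - simpl. repeat (constructor; auto).
  - simpl. repeat (constructor; auto).
  - simpl. unfold dev_pend. simpl. destruct (Nat.leb_spec n k); [lia|]. simpl.
    destruct (Nat.ltb_spec k n); [|lia]. constructor; auto.
  - simpl. unfold dev_pend. simpl. rewrite Nat.eqb_refl, andb_false_r.
    destruct (Nat.ltb_spec (n + i) n); [lia|constructor].
  - simpl. unfold dev_pend. simpl. repeat (constructor; auto).
  - simpl. unfold dev_pend. rewrite H. constructor.
  - simpl. rewrite H. destruct (failing_dec m) as [F|F]; [tauto|]. rewrite H0.
    destruct (same_set_dec (keys m) c) as [S|S]; [|tauto].
    destruct (par_wsm _ _ H4 H) as (W' & _ & _ & Hp). destruct (Hp H0) as (P' & _ & _).
    apply par_subst; auto. apply par_inst.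
    destruct (par_wsm _ _ IHpar2 W') as (_ & _ & _ & Hp'). now apply Hp'.
  - simpl. rewrite H. destruct (failing_dec m) as [F|F]; [tauto|]. rewrite H0.
    destruct (same_set_dec (keys m) c) as [S|S]; [tauto|apply par_refl].
  - simpl. rewrite H. destruct (failing_dec m) as [F|F]; [apply par_refl|tauto].
Qed.

Lemma par_confluent a b c : clos_refl_trans _ par a b -> clos_refl_trans _ par a c ->
  exists d, clos_refl_trans _ par b d /\ clos_refl_trans _ par c d.
Proof.
  intros Hb%clos_rt_rt1n_iff. revert c.
  (* A single step is pushed across a sequence; each square is closed by the complete development of
     its source. *)
  assert (strip : forall x y z, par x y -> clos_refl_trans_1n _ par x z ->
            exists w, clos_refl_trans_1n _ par y w /\ par z w).
  { intros x y z Hxy Hxz. revert y Hxy. induction Hxz as [x|x x' z Hx Hz IH]; intros y Hxy.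
    - exists y. split; auto. constructor.
    - destruct (IH (dev x)) as (w & Hw & Hzw); [now apply par_dev|].
      exists w. split; auto. econstructor; [apply par_dev; eassumption|]. exact Hw. }
  induction Hb as [a|a a' b Ha Hb IH]; intros c Hc.
  - exists c. split; auto. apply rt_refl.
  - apply clos_rt_rt1n_iff in Hc. destruct (strip _ _ _ Ha Hc) as (w & Hw & Hcw).
    apply clos_rt_rt1n_iff in Hw. destruct (IH w Hw) as (d & Hd & Hwd).
    exists d. split; auto. eapply rt_trans; [apply rt_step; eassumption|]. exact Hwd.
Qed.

End Par.

(** * Representation of named terms *)

Definition mulist (mu : option (list (name * term))) : list (name * term) :=
  match mu with None => [] | Some s => s end.

(** The generated principle offers no hypothesis for the terms stored in [mu] and [D]. *)
Lemma term_nested_ind (P : term -> Prop) :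
  (forall x, P (Var x)) -> (forall x, P (Mat x)) ->
  (forall t u, P t -> P u -> P (App t u)) ->
  (forall t u, P t -> P u -> P (Dat t u)) ->
  (forall th p b, P p -> P b -> P (Abs th p b)) ->
  (forall b th mu D, P b -> (forall x a, In (x, a) (mulist mu) -> P a) ->
     (forall a p, In (a, p) D -> P a /\ P p) -> P (Mtc b th mu D)) ->
  forall t, P t.
Proof.
  intros HV HM HA HD HL HX. fix IH 1. destruct t as [x|x|t u|t u|th p b|b th mu D].
  1: apply HV. 1: apply HM. 1: apply HA; apply IH. 1: apply HD; apply IH. 1: apply HL; apply IH.
  apply HX; [apply IH| |].
  - destruct mu as [s|]; simpl; [|tauto].
    induction s as [|[x a] s IHs]; simpl; intros y c; [tauto|]; intros [E|E]; [|exact (IHs _ _ E)].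
    injection E as <- <-. apply IH.
  - induction D as [|[a p] D IHD]; simpl; intros a' p'; [tauto|]; intros [E|E]; [|exact (IHD _ _ E)].
    injection E as <- <-. split; apply IH.
Qed.

Lemma flat_map_map_in {A B C} (F : B -> list C) (G : A -> list C) (h : A -> B) l :
  (forall x, In x l -> F (h x) = G x) -> flat_map F (map h l) = flat_map G l.
Proof. induction l; simpl; intros H; f_equal; auto. Qed.

Lemma inb_spec z l : reflect (In z l) (inb z l).
Proof.
  apply iff_reflect. unfold inb. rewrite existsb_exists. split.
  - intros H. exists z. now rewrite Nat.eqb_refl.
  - intros (y & H & E). apply Nat.eqb_eq in E. now subst.
Qed.

Lemma in_filter_out z th l : In z (filter (fun z => negb (inb z th)) l) <-> In z l /\ ~ In z th.
Proof. rewrite filter_In. destruct (inb_spec z th); simpl; intuition discriminate. Qed.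

Section Unfolding.
Variables (b : term) (th : list name) (mu : option (list (name * term))) (D : list (term * term)).

Ltac nested :=
  simpl; repeat f_equal;
  [ destruct mu as [s|]; simpl; auto; try f_equal;
    induction s as [|[z a] s IH]; simpl; auto; rewrite IH
  | induction D as [|[a p] D' IH]; simpl; auto; rewrite IH ];
  rewrite <- ?app_assoc; auto.

(** Here and below, the local fixpoints of the definitions are traded for [map] and [flat_map], to
    which the library applies. *)
Lemma fv_mtc : fv (Mtc b th mu D) = filter (fun z => negb (inb z th)) (fv b)
  ++ flat_map (fun za => fv (snd za)) (mulist mu)
  ++ flat_map (fun ap => fv (fst ap) ++ fv (snd ap)) D.
Proof. nested. Qed.

Lemma fm_mtc : fm (Mtc b th mu D) = fm b
  ++ flat_map (fun za => fm (snd za)) (mulist mu)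
  ++ flat_map (fun ap => fm (fst ap) ++ filter (fun z => negb (inb z th)) (fm (snd ap))) D.
Proof. nested. Qed.

Lemma names_mtc : names (Mtc b th mu D) = th ++ names b
  ++ flat_map (fun za => fst za :: names (snd za)) (mulist mu)
  ++ flat_map (fun ap => names (fst ap) ++ names (snd ap)) D.
Proof. nested. Qed.

Lemma bnames_mtc : bnames (Mtc b th mu D) = th ++ bnames b
  ++ flat_map (fun za => bnames (snd za)) (mulist mu)
  ++ flat_map (fun ap => bnames (fst ap) ++ bnames (snd ap)) D.
Proof. nested. Qed.

Lemma ren_v_mtc x y : ren_v x y (Mtc b th mu D) =
  Mtc (if inb x th then b else ren_v x y b) th
    (option_map (map (fun za => (fst za, ren_v x y (snd za)))) mu)
    (map (fun ap => (ren_v x y (fst ap), ren_v x y (snd ap))) D).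
Proof. nested. Qed.

Lemma ren_m_mtc x y : ren_m x y (Mtc b th mu D) =
  Mtc (ren_m x y b) th
    (option_map (map (fun za => (fst za, ren_m x y (snd za)))) mu)
    (map (fun ap => (ren_m x y (fst ap), if inb x th then snd ap else ren_m x y (snd ap))) D).
Proof. nested. Qed.

Lemma subst_mtc s : subst s (Mtc b th mu D) =
  Mtc (subst (restrict th s) b) th
    (option_map (map (fun za => (fst za, subst s (snd za)))) mu)
    (map (fun ap => (subst s (fst ap), subst s (snd ap))) D).
Proof.
  simpl; repeat f_equal;
  [ destruct mu as [s0|]; simpl; auto; try f_equal;
    induction s0 as [|[z a] s0 IH]; simpl; auto; rewrite IH
  | induction D as [|[a p] D' IH]; simpl; auto; rewrite IH ]; auto.
Qed.

End Unfolding.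

Lemma fv_fm_names t : incl (fv t) (names t) /\ incl (fm t) (names t).
Proof.
  induction t using term_nested_ind; try (split; intros z; simpl; rewrite ?in_app_iff; intuition auto; fail).
  - split; intros z; simpl; rewrite ?in_app_iff, ?in_filter_out; intuition auto.
  - rewrite fv_mtc, fm_mtc, names_mtc. split; intros z; rewrite !in_app_iff.
    + rewrite in_filter_out. intros [[Hz _]|[Hz|Hz]].
      * right; left. now apply (proj1 IHt).
      * right; right; left. apply in_flat_map in Hz as ((x & a) & Hin & Hz). apply in_flat_map.
        exists (x, a). split; auto. right. now apply (proj1 (H x a Hin)).
      * right; right; right. apply in_flat_map in Hz as ((a & p) & Hin & Hz). apply in_flat_map.
        exists (a, p). split; auto. destruct (H0 a p Hin) as [[Ha _] [Hp _]].
        simpl in *. rewrite in_app_iff in *. intuition auto.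
    + intros [Hz|[Hz|Hz]].
      * right; left. now apply (proj2 IHt).
      * right; right; left. apply in_flat_map in Hz as ((x & a) & Hin & Hz). apply in_flat_map.
        exists (x, a). split; auto. right. now apply (proj2 (H x a Hin)).
      * right; right; right. apply in_flat_map in Hz as ((a & p) & Hin & Hz). apply in_flat_map.
        exists (a, p). split; auto. destruct (H0 a p Hin) as [[_ Ha] [_ Hp]].
        simpl in *. rewrite in_app_iff, in_filter_out in *. intuition auto.
Qed.

(* [PF2 R l m]: a bijection between the two lists, viewed as multisets, matches elements related by [R]. *)
Definition PF2 {A B} (R : A -> B -> Prop) : list A -> list B -> Prop :=
  fix go l m := match l with
                | [] => m = []
                | a :: l' => exists m1 b m2, m = m1 ++ b :: m2 /\ R a b /\ go l' (m1 ++ m2)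
                end.

Lemma PF2_spec {A B} (R : A -> B -> Prop) l m :
  PF2 R l m <-> exists m', Permutation m' m /\ Forall2 R l m'.
Proof.
  split.
  - revert m. induction l as [|a l IH]; simpl; intros m.
    + intros ->. exists []. auto.
    + intros (m1 & b & m2 & -> & Hab & H). apply IH in H as (m' & HP & HF).
      exists (b :: m'). split; auto. now rewrite <- Permutation_middle, HP.
  - intros (m' & HP & HF). revert m HP. induction HF as [|a b l m' Hab HF IH]; intros m HP; simpl.
    + now apply Permutation_nil.
    + assert (Hb : In b m) by (eapply Permutation_in; [exact HP|now left]).
      apply in_split in Hb as (m1 & m2 & ->). exists m1, b, m2. split; [|split]; auto.
      apply IH. now apply (Permutation_cons_app_inv m1 m2 (a := b)).
Qed.

Lemma PF2_perm {A B} (R : A -> B -> Prop) l l' m m' :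
  Permutation l l' -> Permutation m m' -> PF2 R l m -> PF2 R l' m'.
Proof.
  intros Hl Hm. rewrite !PF2_spec. intros (k & HP & HF).
  destruct (Permutation_Forall2 Hl HF) as (k' & Hk & HF').
  exists k'. split; auto. now rewrite <- Hk, HP.
Qed.

Lemma PF2_map {A B A' B'} (R : A -> B -> Prop) (R' : A' -> B' -> Prop) h k l m :
  PF2 R l m -> (forall x y, In x l -> In y m -> R x y -> R' (h x) (k y)) -> PF2 R' (map h l) (map k m).
Proof.
  revert m. induction l as [|a l IH]; simpl; intros m.
  - now intros ->.
  - intros (m1 & b & m2 & -> & Hab & H) HR. exists (map k m1), (k b), (map k m2).
    rewrite map_app. simpl. split; [|split]; auto.
    + apply HR; auto. apply in_elt.
    + rewrite <- map_app. apply IH; auto. intros x y Hx Hy. apply HR; auto.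
      rewrite in_app_iff in *. simpl. tauto.
Qed.

Lemma PF2_impl {A B} (R R' : A -> B -> Prop) l m :
  PF2 R l m -> (forall x y, In x l -> In y m -> R x y -> R' x y) -> PF2 R' l m.
Proof. intros H HR. rewrite <- (map_id l), <- (map_id m). eapply PF2_map; eauto. Qed.

Lemma PF2_map_l {A B A'} (R : A -> B -> Prop) (R' : A' -> B -> Prop) h l m :
  (forall x y, In x l -> R' (h x) y <-> R x y) -> PF2 R' (map h l) m <-> PF2 R l m.
Proof.
  revert m. induction l as [|a l IH]; simpl; intros m HR; [tauto|].
  split; intros (m1 & b & m2 & -> & Hab & H); exists m1, b, m2; (split; [|split]); auto;
    try (apply IH; auto; fail); apply HR; auto.
Qed.

Lemma PF2_app_l {A B} (R : A -> B -> Prop) l m1 m2 : PF2 R l (m1 ++ m2) ->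
  exists l1 l2, Permutation l (l1 ++ l2) /\ PF2 R l1 m1 /\ PF2 R l2 m2.
Proof.
  rewrite PF2_spec. intros (m' & HP & HF). apply Forall2_flip in HF.
  destruct (Permutation_Forall2 HP HF) as (l' & Hl & HF').
  apply Forall2_app_inv_l in HF' as (l1 & l2 & H1 & H2 & ->).
  exists l1, l2. split; auto.
  split; apply PF2_spec; eexists; (split; [reflexivity|]); now apply Forall2_flip.
Qed.

Lemma PF2_app {A B} (R : A -> B -> Prop) l1 l2 m1 m2 :
  PF2 R l1 m1 -> PF2 R l2 m2 -> PF2 R (l1 ++ l2) (m1 ++ m2).
Proof.
  rewrite !PF2_spec. intros (k1 & P1 & F1) (k2 & P2 & F2). exists (k1 ++ k2). split.
  - now rewrite P1, P2.
  - now apply Forall2_app.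
Qed.

Lemma PF2_mid {A B} (R : A -> B -> Prop) l1 a l2 m : PF2 R (l1 ++ a :: l2) m ->
  exists m1 b m2, m = m1 ++ b :: m2 /\ R a b /\ PF2 R (l1 ++ l2) (m1 ++ m2).
Proof.
  intros H. apply (PF2_perm R _ (a :: l1 ++ l2) m m) in H; auto.
  symmetry. apply Permutation_middle.
Qed.

Lemma PF2_insert {A B} (R : A -> B -> Prop) l1 a l2 m1 b m2 :
  R a b -> PF2 R (l1 ++ l2) (m1 ++ m2) -> PF2 R (l1 ++ a :: l2) (m1 ++ b :: m2).
Proof.
  intros Hab H. apply (PF2_perm R (a :: l1 ++ l2) _ (m1 ++ b :: m2) _); auto.
  - apply Permutation_middle.
  - simpl. eauto 6.
Qed.

(** Composing one bijection with the inverse of the other. It will compare two named lists that are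
    read off the same match tree. *)
Lemma PF2_common {A B} (R : A -> B -> Prop) (E : A -> A -> Prop) l l' m :
  PF2 R l m -> PF2 R l' m -> (forall x y z, In z m -> R x z -> R y z -> E x y) ->
  exists l1, Permutation l l1 /\ Forall2 E l1 l'.
Proof.
  rewrite !PF2_spec. intros (k & P1 & F1) (k' & P2 & F2) HE.
  assert (P : Permutation k k') by now rewrite P1, P2.
  apply Forall2_flip in F1. destruct (Permutation_Forall2 P F1) as (l1 & Hl & F).
  exists l1. split; auto. apply Forall2_flip in F. clear - F F2 HE P2.
  assert (HE' : forall x y z, In z k' -> R x z -> R y z -> E x y).
  { intros x y z Hz. apply HE. eapply Permutation_in; eauto. }
  clear HE P2. revert l' F2. induction F; intros l0' F2; inversion F2; subst; constructor.
  - eapply HE'; eauto. now left.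
  - apply IHF; auto. intros. eapply HE'; eauto. now right.
Qed.

(** * Index assignments under a binder list *)

Fixpoint psh (th : list name) (f : name -> nat) (x : name) : nat :=
  match th with
  | [] => f x
  | y :: th' => if x =? y then 0 else S (psh th' f x)
  end.

(** A name outside [th] receives [length th + z], so the coding is injective on all names. This
    matters because a decided match may have keys outside its binder list. *)
Definition idx (th : list name) (z : name) : nat := psh th id z.

Lemma psh_in th f g x : In x th -> psh th f x < length th /\ psh th f x = psh th g x.
Proof.
  induction th as [|y th IH]; simpl; [tauto|]. intros H.
  destruct (Nat.eqb_spec x y); [lia|]. destruct IH; [intuition congruence|]. lia.
Qed.

Lemma psh_notin th f x : ~ In x th -> psh th f x = length th + f x.
Proof.
  induction th as [|y th IH]; simpl; auto. intros H.
  destruct (Nat.eqb_spec x y); [intuition congruence|]. rewrite IH; tauto.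
Qed.

Lemma psh_lt th f x : psh th f x < length th <-> In x th.
Proof.
  split; [|apply (psh_in th f f)]. intros H. destruct (in_dec Nat.eq_dec x th); auto.
  rewrite psh_notin in H; auto. lia.
Qed.

Lemma psh_ext th f g x : (~ In x th -> f x = g x) -> psh th f x = psh th g x.
Proof.
  intros H. destruct (in_dec Nat.eq_dec x th); [now apply psh_in|]. rewrite !psh_notin; auto.
Qed.

Lemma psh_comp th r f : psh th (fun x => r (f x)) = fun x => up (length th) r (psh th f x).
Proof.
  extensionality x. destruct (in_dec Nat.eq_dec x th).
  - rewrite up_lt by now apply psh_lt. now apply psh_in.
  - rewrite !psh_notin; auto. now rewrite up_add.
Qed.

Definition inj (f : name -> nat) : Prop := forall x y, f x = f y -> x = y.

Lemma psh_inj th f : inj f -> inj (psh th f).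
Proof.
  intros H. induction th as [|z th IH]; intros x y; simpl; [apply H|].
  destruct (Nat.eqb_spec x z), (Nat.eqb_spec y z); intros E; try lia.
  apply IH. lia.
Qed.

Lemma idx_inj th : inj (idx th).
Proof. apply psh_inj. now intros x y. Qed.

Lemma rn_same x y : rn x y x = y.
Proof. unfold rn. now rewrite Nat.eqb_refl. Qed.

Lemma rn_other x y z : z <> x -> rn x y z = z.
Proof. unfold rn. destruct (Nat.eqb_spec z x); tauto. Qed.

(** A fresh name put in the place of [x] keeps every first occurrence where it was; this is why
    alpha-conversion leaves the tree unchanged. *)
Lemma psh_map_rn th f x y z : ~ In y th -> z <> y -> (z = x -> In x th) ->
  psh (map (rn x y) th) f (rn x y z) = psh th f z.
Proof.
  induction th as [|w th IH]; simpl; intros Hy Hz Hx.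
  - rewrite rn_other; tauto.
  - destruct (Nat.eqb_spec z w) as [->|n].
    + now rewrite Nat.eqb_refl.
    + destruct (Nat.eqb_spec (rn x y z) (rn x y w)) as [E|_].
      * unfold rn in E. destruct (Nat.eqb_spec z x), (Nat.eqb_spec w x); intuition congruence.
      * f_equal. apply IH; auto. intros ->. destruct (Hx eq_refl); [congruence|assumption].
Qed.

Lemma psh_rn_outer th f f' x y z : ~ In x th -> ~ In y th -> z <> y ->
  (f' (rn x y z) = f z) -> psh th f' (rn x y z) = psh th f z.
Proof.
  intros Hx Hy Hz E. destruct (in_dec Nat.eq_dec z th) as [i|n].
  - rewrite rn_other by (intros ->; tauto). now apply psh_in.
  - rewrite (psh_notin th f), psh_notin, E; auto. unfold rn. destruct (z =? x); assumption.
Qed.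

(* [Rep f g t d]: the tree term [d] represents the named term [t], where [f] and [g] give the indices of free
   variables and free matchables. The keys of [mu] are numbered by their position in [th]. When [mu] is bottom
   the bindings recorded in the tree have no counterpart in [t]. *)
Fixpoint Rep (f g : name -> nat) (t : term) (d : tm) : Prop :=
  match t, d with
  | Var x, TV i => f x = i
  | Mat x, TM i => g x = i
  | App t u, TApp t' u' => Rep f g t t' /\ Rep f g u u'
  | Dat t u, TDat t' u' => Rep f g t t' /\ Rep f g u u'
  | Abs th p b, TAbs c p' b' =>
      c = map (idx th) th /\ Rep f (psh th g) p p' /\ Rep (psh th f) g b b'
  | Mtc b th mu D, TMtc c b' m =>
      c = map (idx th) th /\ Rep (psh th f) g b b' /\ wsm m = true /\
      match mu with
      | None => failing m
      | Some s => ~ failing m /\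
          PF2 (fun za ka => match za with (z, a) => idx th z = fst ka /\ Rep f g a (snd ka) end) s (binds m)
      end /\
      PF2 (fun ap q => match ap with (a, p) =>
             fst (fst q) = length th /\ Rep f g a (snd (fst q)) /\ Rep f (psh th g) p (snd q) end) D (pend m)
  | _, _ => False
  end.

(** [RepB], [RepP] and [RepMu] restate the relations spelled out inside [Rep], where pairs are
    destructed so that the recursive calls are visibly on subterms. *)
Definition RepB (th : list name) (f g : name -> nat) (za : name * term) (ka : nat * tm) : Prop :=
  idx th (fst za) = fst ka /\ Rep f g (snd za) (snd ka).

Definition RepP (th : list name) (f g : name -> nat) (ap : term * term) (q : nat * tm * tm) : Prop :=
  fst (fst q) = length th /\ Rep f g (fst ap) (snd (fst q)) /\ Rep f (psh th g) (snd ap) (snd q).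

Definition RepMu (th : list name) (f g : name -> nat) (mu : option (list (name * term))) (m : tm) : Prop :=
  match mu with
  | None => failing m
  | Some s => ~ failing m /\ PF2 (RepB th f g) s (binds m)
  end.

Lemma Rep_mtc f g b th mu D c b' m : Rep f g (Mtc b th mu D) (TMtc c b' m) <->
  c = map (idx th) th /\ Rep (psh th f) g b b' /\ wsm m = true /\
  RepMu th f g mu m /\ PF2 (RepP th f g) D (pend m).
Proof.
  simpl. rewrite <- (map_id D) at 1. rewrite (PF2_map_l (RepP th f g)) by (intros [] ?; reflexivity).
  destruct mu as [s|]; [|reflexivity].
  rewrite <- (map_id s) at 1. rewrite (PF2_map_l (RepB th f g)) by (intros [] ?; reflexivity).
  reflexivity.
Qed.

Ltac inv_rep H :=
  match type of H with
  | Rep _ _ ?t ?d => first [ is_var d; destruct d; try contradiction H | is_var t; destruct t; try contradiction H ]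
  end.

Lemma Rep_ext t : forall f g f' g' d, Rep f g t d ->
  (forall x, In x (fv t) -> f x = f' x) -> (forall x, In x (fm t) -> g x = g' x) -> Rep f' g' t d.
Proof.
  induction t using term_nested_ind; intros f g f' g' d HR Hf Hg; inv_rep HR.
  - simpl in *. rewrite <- HR. symmetry. auto.
  - simpl in *. rewrite <- HR. symmetry. auto.
  - destruct HR. simpl in *. split; [eapply IHt1|eapply IHt2]; eauto; intros; first [apply Hf|apply Hg]; auto using in_or_app.
  - destruct HR. simpl in *. split; [eapply IHt1|eapply IHt2]; eauto; intros; first [apply Hf|apply Hg]; auto using in_or_app.
  - destruct HR as (E & Hp & Hb). simpl in *. split; [|split]; auto.
    + eapply IHt1; eauto.
      * intros. apply Hf. auto using in_or_app.
      * intros. apply psh_ext. intros. apply Hg. apply in_or_app. left. now apply in_filter_out.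
    + eapply IHt2; eauto.
      * intros. apply psh_ext. intros. apply Hf. apply in_or_app. right. now apply in_filter_out.
      * intros. apply Hg. auto using in_or_app.
  - apply Rep_mtc in HR as (E & Hb & W & Hm & HD). apply Rep_mtc.
    rewrite fv_mtc in Hf. rewrite fm_mtc in Hg.
    split; [|split; [|split; [|split]]]; auto.
    + eapply IHt; eauto.
      * intros. apply psh_ext. intros. apply Hf. apply in_or_app. left. now apply in_filter_out.
      * intros. apply Hg. apply in_or_app. auto.
    + destruct mu as [s|]; auto. destruct Hm as [Hm1 Hm2]. split; auto.
      eapply PF2_impl; eauto. intros [z a] ka Hin _ [E1 E2]. split; auto. simpl in *.
      eapply H; eauto.
      * intros. apply Hf. rewrite !in_app_iff, !in_flat_map. right; left. now exists (z, a).
      * intros. apply Hg. rewrite !in_app_iff, !in_flat_map. right; left. now exists (z, a).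
    + eapply PF2_impl; eauto. intros [a p] q Hin _ (E1 & E2 & E3). destruct (H0 a p Hin) as [Ha Hp].
      simpl in *. split; [|split]; auto; simpl; [eapply Ha|eapply Hp]; eauto.
      * intros. apply Hf. rewrite !in_app_iff, !in_flat_map. right; right. exists (a, p). split; auto. simpl. auto using in_or_app.
      * intros. apply Hg. rewrite !in_app_iff, !in_flat_map. right; right. exists (a, p). split; auto. simpl. auto using in_or_app.
      * intros. apply Hf. rewrite !in_app_iff, !in_flat_map. right; right. exists (a, p). split; auto. simpl. auto using in_or_app.
      * intros. apply psh_ext. intros. apply Hg. rewrite !in_app_iff, !in_flat_map. right; right. exists (a, p).
        split; auto. simpl. apply in_or_app. right. now apply in_filter_out.
Qed.

Lemma keys_ren r q m : keys (ren r q m) = keys m.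
Proof. unfold keys. destruct (wsm_ren r q m) as (_ & _ & -> & _). apply map_fst_snd_map. Qed.

Lemma Rep_ren t : forall f g r q d, Rep f g t d ->
  Rep (fun x => r (f x)) (fun x => q (g x)) t (ren r q d).
Proof.
  induction t using term_nested_ind; intros f g r q d HR; inv_rep HR; try (simpl in *; subst; intuition auto; fail).
  - destruct HR as (-> & Hp & Hb). simpl. rewrite (psh_comp th q g), (psh_comp th r f), length_map. auto.
  - apply Rep_mtc in HR as (-> & Hb & W & Hm & HD).
    cbn [ren]. apply Rep_mtc. destruct (wsm_ren r q d2) as (E1 & E2 & E3 & E4).
    rewrite E1, E4, length_map. split; [|split; [|split; [|split]]]; auto.
    + rewrite (psh_comp th r f). now apply IHt.
    + pose proof (failing_map d2 (ren r q d2) E2 (keys_ren r q d2)) as F.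
      destruct mu as [s|]; simpl in *; rewrite F; auto.
      destruct Hm as [Hm1 Hm2]. split; auto. rewrite E3, <- (map_id s).
      eapply PF2_map; eauto. intros [z a] ka Hin _ [E Ha]. split; auto. simpl in *.
      eapply H; eauto.
    + rewrite <- (map_id D). eapply PF2_map; eauto. intros [a p] [[n A] P] Hin _ (-> & Ea & Ep).
      destruct (H0 a p Hin) as [Ha Hp]. simpl in *. split; [|split]; simpl; auto.
      rewrite (psh_comp th q g). auto.
Qed.

Lemma not_in_app {A} (y : A) l1 l2 : ~ In y (l1 ++ l2) <-> ~ In y l1 /\ ~ In y l2.
Proof. rewrite in_app_iff. tauto. Qed.

Lemma not_in_flat_map {A B} (F : A -> list B) y l :
  ~ In y (flat_map F l) -> forall x, In x l -> ~ In y (F x).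
Proof. rewrite in_flat_map. intros H x Hx Hy. apply H. eauto. Qed.

Lemma Rep_ren_v t : forall f f' g d x y, ~ In y (names t) ->
  (forall z, z <> y -> f' (rn x y z) = f z) -> Rep f' g (ren_v x y t) d <-> Rep f g t d.
Proof.
  (* A body below [th]: if [x] is bound there, the renaming stops and it suffices that both
     assignments agree on the free variables of the body. *)
  assert (HB : forall b, (forall f f' g d x y, ~ In y (names b) ->
    (forall z, z <> y -> f' (rn x y z) = f z) -> Rep f' g (ren_v x y b) d <-> Rep f g b d) ->
    forall th f f' g d x y, ~ In y (names b) -> ~ In y th -> (forall z, z <> y -> f' (rn x y z) = f z) ->
    Rep (psh th f') g (if inb x th then b else ren_v x y b) d <-> Rep (psh th f) g b d).
  { intros b IH th f f' g d x y Hy Ht Hf. destruct (inb_spec x th) as [i|i].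
    - assert (E : forall z, In z (fv b) -> psh th f z = psh th f' z).
      { intros z Hz%fv_fm_names. apply psh_ext. intros Hz'. rewrite <- Hf, rn_other; congruence. }
      split; intros H; eapply Rep_ext; eauto. intros. symmetry. auto.
    - apply IH; auto. intros z Hz. apply psh_rn_outer; auto. }
  induction t using term_nested_ind; intros f f' g d w y Hy Hf.
  - destruct d; simpl; try tauto. simpl in Hy. rewrite Hf; tauto.
  - reflexivity.
  - simpl in *. apply not_in_app in Hy as [Hy1 Hy2]. destruct d; simpl; try tauto.
    rewrite (IHt1 f f'), (IHt2 f f'); tauto.
  - simpl in *. apply not_in_app in Hy as [Hy1 Hy2]. destruct d; simpl; try tauto.
    rewrite (IHt1 f f'), (IHt2 f f'); tauto.
  - simpl in Hy. rewrite !not_in_app in Hy. destruct Hy as (Ht & Hp & Hb). destruct d; simpl; try tauto.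
    rewrite (IHt1 f f'), (HB t2 IHt2 th f f'); auto. reflexivity.
  - rewrite names_mtc, !not_in_app in Hy. destruct Hy as (Ht & Hb & Hm & HD).
    rewrite ren_v_mtc. destruct d; try reflexivity. rewrite !Rep_mtc.
    rewrite (HB t IHt th f f'); auto.
    rewrite (PF2_map_l (RepP th f g)).
    2:{ intros [a p] q Hin. destruct (H0 a p Hin) as [Ha Hp]. pose proof (not_in_flat_map _ _ _ HD _ Hin) as Hn.
        simpl in Hn. apply not_in_app in Hn as [Hn1 Hn2]. unfold RepP. simpl.
        rewrite (Ha f f'), (Hp f f'); auto. reflexivity. }
    destruct mu as [s|]; simpl; [|reflexivity]. rewrite (PF2_map_l (RepB th f g)); [reflexivity|].
    intros [z a] ka Hin. pose proof (not_in_flat_map _ _ _ Hm _ Hin) as Hn. simpl in Hn.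
    unfold RepB. simpl. rewrite (H z a Hin f f'); auto. reflexivity.
Qed.

Lemma Rep_ren_m t : forall f g g' d x y, ~ In y (names t) ->
  (forall z, z <> y -> g' (rn x y z) = g z) -> Rep f g' (ren_m x y t) d <-> Rep f g t d.
Proof.
  assert (HB : forall b, (forall f g g' d x y, ~ In y (names b) ->
    (forall z, z <> y -> g' (rn x y z) = g z) -> Rep f g' (ren_m x y b) d <-> Rep f g b d) ->
    forall th f g g' d x y, ~ In y (names b) -> ~ In y th -> (forall z, z <> y -> g' (rn x y z) = g z) ->
    Rep f (psh th g') (if inb x th then b else ren_m x y b) d <-> Rep f (psh th g) b d).
  { intros b IH th f g g' d x y Hy Ht Hg. destruct (inb_spec x th) as [i|i].
    - assert (E : forall z, In z (fm b) -> psh th g z = psh th g' z).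
      { intros z Hz%fv_fm_names. apply psh_ext. intros Hz'. rewrite <- Hg, rn_other; congruence. }
      split; intros H; eapply Rep_ext; eauto. intros. symmetry. auto.
    - apply IH; auto. intros z Hz. apply psh_rn_outer; auto. }
  induction t using term_nested_ind; intros f g g' d w y Hy Hg.
  - reflexivity.
  - destruct d; simpl; try tauto. simpl in Hy. rewrite Hg; tauto.
  - simpl in *. apply not_in_app in Hy as [Hy1 Hy2]. destruct d; simpl; try tauto.
    rewrite (IHt1 f g), (IHt2 f g); tauto.
  - simpl in *. apply not_in_app in Hy as [Hy1 Hy2]. destruct d; simpl; try tauto.
    rewrite (IHt1 f g), (IHt2 f g); tauto.
  - simpl in Hy. rewrite !not_in_app in Hy. destruct Hy as (Ht & Hp & Hb). destruct d; simpl; try tauto.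
    rewrite (IHt2 (psh th f) g), (HB t1 IHt1 th f g); auto. reflexivity.
  - rewrite names_mtc, !not_in_app in Hy. destruct Hy as (Ht & Hb & Hm & HD).
    rewrite ren_m_mtc. destruct d; try reflexivity. rewrite !Rep_mtc.
    rewrite (IHt (psh th f) g); auto.
    rewrite (PF2_map_l (RepP th f g)).
    2:{ intros [a p] q Hin. destruct (H0 a p Hin) as [Ha Hp]. pose proof (not_in_flat_map _ _ _ HD _ Hin) as Hn.
        simpl in Hn. apply not_in_app in Hn as [Hn1 Hn2]. unfold RepP. simpl.
        rewrite (Ha f g), (HB p Hp th f g); auto. reflexivity. }
    destruct mu as [s|]; simpl; [|reflexivity]. rewrite (PF2_map_l (RepB th f g)); [reflexivity|].
    intros [z a] ka Hin. pose proof (not_in_flat_map _ _ _ Hm _ Hin) as Hn. simpl in Hn.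
    unfold RepB. simpl. rewrite (H z a Hin f g); auto. reflexivity.
Qed.

Lemma PF2_mid_iff {A B} (R : A -> B -> Prop) l1 a a' l2 m :
  (forall b, R a b <-> R a' b) -> PF2 R (l1 ++ a :: l2) m <-> PF2 R (l1 ++ a' :: l2) m.
Proof.
  intros H. split; intros HP; apply PF2_mid in HP as (m1 & b & m2 & -> & Hb & HP');
    apply PF2_insert; auto; now apply H.
Qed.

Lemma map_idx_rn th x y : In x th -> ~ In y th ->
  map (idx (map (rn x y) th)) (map (rn x y) th) = map (idx th) th.
Proof.
  intros Hx Hy. rewrite map_map. apply map_ext_in. intros z Hz. apply psh_map_rn; auto. congruence.
Qed.

Lemma Rep_eq_base t u : eq_base t u -> forall f g d, Rep f g t d <-> Rep f g u d.
Proof.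
  destruct 1 as [th p b x y Hx Hy|b th mu D x y Hx Hy|b th mu D D' HP|b th s s' D HP]; intros f g d;
    destruct d; try reflexivity.
  - simpl in Hy. rewrite !not_in_app in Hy. destruct Hy as (Ht & Hp & Hb). simpl.
    rewrite map_idx_rn, (Rep_ren_m p f (psh th g)), (Rep_ren_v b (psh th f)); auto; try reflexivity;
      intros; apply psh_map_rn; auto; congruence.
  - rewrite names_mtc, !not_in_app in Hy. destruct Hy as (Ht & Hb & Hm & HD).
    rewrite !Rep_mtc, map_idx_rn, (Rep_ren_v b (psh th f)); auto;
      [|intros; apply psh_map_rn; auto; congruence].
    rewrite (PF2_map_l (RepP th f g)).
    2:{ intros [a p] q Hin. pose proof (not_in_flat_map _ _ _ HD _ Hin) as Hn.
        simpl in Hn. apply not_in_app in Hn as [Hn1 Hn2]. unfold RepP. simpl.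
        rewrite length_map, (Rep_ren_m p f (psh th g)); auto; [reflexivity|].
        intros; apply psh_map_rn; auto; congruence. }
    destruct mu as [s|]; simpl; [|reflexivity]. rewrite (PF2_map_l (RepB th f g)); [reflexivity|].
    intros [z a] ka Hin. pose proof (not_in_flat_map _ _ _ Hm _ Hin) as Hn. simpl in Hn.
    unfold RepB. simpl. unfold idx at 1. rewrite psh_map_rn; auto. reflexivity.
  - rewrite !Rep_mtc. split; intros (? & ? & ? & ? & HD); repeat split; auto;
      eapply PF2_perm; try exact HD; auto. now symmetry.
  - rewrite !Rep_mtc. split; intros (? & ? & ? & [? Hs] & ?); repeat split; auto;
      eapply PF2_perm; try exact Hs; auto. now symmetry.
Qed.

Lemma Rep_ctx_eq t u : ctx eq_base t u -> forall f g d, Rep f g t d <-> Rep f g u d.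
Proof.
  induction 1; intros f g d; [now apply Rep_eq_base|destruct d; try reflexivity..];
    try (simpl; rewrite IHctx; reflexivity).
  - rewrite !Rep_mtc. simpl. rewrite (PF2_mid_iff (RepB th f g) s1 (x, a) (x, a')); [reflexivity|].
    intros q. unfold RepB. simpl. now rewrite IHctx.
  - rewrite !Rep_mtc. simpl. rewrite (PF2_mid_iff (RepP th f g) D1 (a, p) (a', p)); [reflexivity|].
    intros q. unfold RepP. simpl. now rewrite IHctx.
  - rewrite !Rep_mtc. simpl. rewrite (PF2_mid_iff (RepP th f g) D1 (a, p) (a, p')); [reflexivity|].
    intros q. unfold RepP. simpl. now rewrite IHctx.
Qed.

Lemma Rep_tequiv t u : tequiv t u -> forall f g d, Rep f g t d <-> Rep f g u d.
Proof.
  induction 1; intros f g d.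
  - now apply Rep_ctx_eq.
  - reflexivity.
  - symmetry. apply IHclos_refl_sym_trans.
  - rewrite IHclos_refl_sym_trans1. apply IHclos_refl_sym_trans2.
Qed.

(** * Renaming of binders; uniqueness and existence of representations *)

(** Quantifying over [R] lets the same contexts serve for [tequiv] and for reduction. *)
Definition compat (C : term -> term) : Prop := forall R t u, ctx R t u -> ctx R (C t) (C u).

Lemma tequiv_refl t : tequiv t t.
Proof. apply rst_refl. Qed.

Lemma tequiv_sym t u : tequiv t u -> tequiv u t.
Proof. apply rst_sym. Qed.

Lemma tequiv_trans t u v : tequiv t u -> tequiv u v -> tequiv t v.
Proof. apply rst_trans. Qed.

Lemma tequiv_base t u : eq_base t u -> tequiv t u.
Proof. intros. apply rst_step. now constructor. Qed.

Lemma tequiv_compat C t u : compat C -> tequiv t u -> tequiv (C t) (C u).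
Proof.
  intros HC. induction 1.
  - apply rst_step. now apply HC.
  - apply rst_refl.
  - now apply rst_sym.
  - eapply rst_trans; eauto.
Qed.

Lemma compat_abs_p th b : compat (fun p => Abs th p b).
Proof. intros R t u H. now constructor. Qed.
Lemma compat_abs_b th p : compat (fun b => Abs th p b).
Proof. intros R t u H. now constructor. Qed.
Lemma compat_app_l u : compat (fun t => App t u).
Proof. intros R t v H. now constructor. Qed.
Lemma compat_app_r t : compat (fun u => App t u).
Proof. intros R u v H. now constructor. Qed.
Lemma compat_dat_l u : compat (fun t => Dat t u).
Proof. intros R t v H. now constructor. Qed.
Lemma compat_dat_r t : compat (fun u => Dat t u).
Proof. intros R u v H. now constructor. Qed.
Lemma compat_mtc_b th mu D : compat (fun b => Mtc b th mu D).
Proof. intros R t u H. now constructor. Qed.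
Lemma compat_mtc_mu b th s1 x s2 D : compat (fun a => Mtc b th (Some (s1 ++ (x, a) :: s2)) D).
Proof. intros R t u H. now constructor. Qed.
Lemma compat_mtc_D1 b th mu D1 p D2 : compat (fun a => Mtc b th mu (D1 ++ (a, p) :: D2)).
Proof. intros R t u H. now constructor. Qed.
Lemma compat_mtc_D2 b th mu D1 a D2 : compat (fun p => Mtc b th mu (D1 ++ (a, p) :: D2)).
Proof. intros R t u H. now constructor. Qed.

Lemma tequiv_app t t' u u' : tequiv t t' -> tequiv u u' -> tequiv (App t u) (App t' u').
Proof.
  intros Ht Hu. eapply tequiv_trans; [exact (tequiv_compat _ _ _ (compat_app_l u) Ht)
                                     |exact (tequiv_compat _ _ _ (compat_app_r t') Hu)].
Qed.

Lemma tequiv_dat t t' u u' : tequiv t t' -> tequiv u u' -> tequiv (Dat t u) (Dat t' u').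
Proof.
  intros Ht Hu. eapply tequiv_trans; [exact (tequiv_compat _ _ _ (compat_dat_l u) Ht)
                                     |exact (tequiv_compat _ _ _ (compat_dat_r t') Hu)].
Qed.

Lemma tequiv_abs th p p' b b' : tequiv p p' -> tequiv b b' -> tequiv (Abs th p b) (Abs th p' b').
Proof.
  intros Hp Hb. eapply tequiv_trans; [exact (tequiv_compat _ _ _ (compat_abs_p th b) Hp)
                                     |exact (tequiv_compat _ _ _ (compat_abs_b th p') Hb)].
Qed.

Lemma tequiv_mtc_D b th mu D D' :
  Forall2 (fun x y => tequiv (fst x) (fst y) /\ tequiv (snd x) (snd y)) D D' ->
  forall D0, tequiv (Mtc b th mu (D0 ++ D)) (Mtc b th mu (D0 ++ D')).
Proof.
  induction 1 as [|[a p] [a' p'] D D' [Ha Hp] H IH]; intros D0; [apply tequiv_refl|]. simpl in *.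
  eapply tequiv_trans; [exact (tequiv_compat _ _ _ (compat_mtc_D1 b th mu D0 p D) Ha)|].
  eapply tequiv_trans; [exact (tequiv_compat _ _ _ (compat_mtc_D2 b th mu D0 a' D) Hp)|].
  specialize (IH (D0 ++ [(a', p')])). now rewrite <- !app_assoc in IH.
Qed.

Lemma tequiv_mtc_mu b th s s' D :
  Forall2 (fun x y => fst x = fst y /\ tequiv (snd x) (snd y)) s s' ->
  forall s0, tequiv (Mtc b th (Some (s0 ++ s)) D) (Mtc b th (Some (s0 ++ s')) D).
Proof.
  induction 1 as [|[x a] [x' a'] s s' [Ha Hp] H IH]; intros s0; [apply tequiv_refl|]. simpl in *. subst x'.
  eapply tequiv_trans; [exact (tequiv_compat _ _ _ (compat_mtc_mu b th s0 x s D) Hp)|].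
  specialize (IH (s0 ++ [(x, a')])). now rewrite <- !app_assoc in IH.
Qed.

Lemma names_ren_v x y z t : In z (names (ren_v x y t)) -> z = y \/ In z (names t).
Proof.
  induction t using term_nested_ind.
  - simpl. unfold rn. destruct (x0 =? x); intuition auto.
  - simpl. auto.
  - simpl. rewrite !in_app_iff. intuition auto.
  - simpl. rewrite !in_app_iff. intuition auto.
  - simpl. rewrite !in_app_iff. destruct (inb x th); intuition auto.
  - rewrite ren_v_mtc, !names_mtc, !in_app_iff. intros [Hz|[Hz|[Hz|Hz]]]; auto.
    + destruct (inb x th); intuition auto.
    + apply in_flat_map in Hz as ((w & a) & Hin & Hz). destruct mu as [s|]; simpl in *; [|tauto].
      apply in_map_iff in Hin as ((w' & a') & E & Hin). injection E as -> <-. simpl in Hz.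
      assert (Hk : z = y \/ w = z \/ In z (names a')) by (destruct Hz; [auto|destruct (H _ _ Hin); auto]).
      destruct Hk; auto. right; right; right; left. apply in_flat_map. exists (w, a'). simpl. auto.
    + apply in_flat_map in Hz as ((a & p) & Hin & Hz).
      apply in_map_iff in Hin as ((a' & p') & E & Hin). injection E as <- <-. simpl in Hz.
      destruct (H0 _ _ Hin) as [Ha Hp]. rewrite in_app_iff in Hz.
      assert (Hk : z = y \/ In z (names a' ++ names p')) by (rewrite in_app_iff; intuition auto).
      destruct Hk; auto. right; right; right; right. apply in_flat_map. exists (a', p'). simpl. auto.
Qed.

Lemma names_ren_m x y z t : In z (names (ren_m x y t)) -> z = y \/ In z (names t).
Proof.
  induction t using term_nested_ind.
  - simpl. auto.
  - simpl. unfold rn. destruct (x0 =? x); intuition auto.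
  - simpl. rewrite !in_app_iff. intuition auto.
  - simpl. rewrite !in_app_iff. intuition auto.
  - simpl. rewrite !in_app_iff. destruct (inb x th); intuition auto.
  - rewrite ren_m_mtc, !names_mtc, !in_app_iff. intros [Hz|[Hz|[Hz|Hz]]]; auto.
    + intuition auto.
    + apply in_flat_map in Hz as ((w & a) & Hin & Hz). destruct mu as [s|]; simpl in *; [|tauto].
      apply in_map_iff in Hin as ((w' & a') & E & Hin). injection E as -> <-. simpl in Hz.
      assert (Hk : z = y \/ w = z \/ In z (names a')) by (destruct Hz; [auto|destruct (H _ _ Hin); auto]).
      destruct Hk; auto. right; right; right; left. apply in_flat_map. exists (w, a'). simpl. auto.
    + apply in_flat_map in Hz as ((a & p) & Hin & Hz).
      apply in_map_iff in Hin as ((a' & p') & E & Hin). injection E as <- <-. simpl in Hz.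
      destruct (H0 _ _ Hin) as [Ha Hp]. rewrite in_app_iff in Hz.
      assert (Hk : z = y \/ In z (names a' ++ names p'))
        by (rewrite in_app_iff; destruct (inb x th); intuition auto).
      destruct Hk; auto. right; right; right; right. apply in_flat_map. exists (a', p'). simpl. auto.
Qed.

Lemma bnames_ren_v x y t : bnames (ren_v x y t) = bnames t.
Proof.
  induction t using term_nested_ind; try (simpl; congruence).
  - simpl. destruct (inb x th); congruence.
  - rewrite ren_v_mtc, !bnames_mtc. f_equal. f_equal; [destruct (inb x th); congruence|]. f_equal.
    + destruct mu as [s|]; simpl; auto. apply flat_map_map_in. intros [w a] Hin. simpl. eauto.
    + apply flat_map_map_in. intros [a p] Hin. simpl. destruct (H0 a p Hin). congruence.
Qed.

Lemma bnames_ren_m x y t : bnames (ren_m x y t) = bnames t.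
Proof.
  induction t using term_nested_ind; try (simpl; congruence).
  - simpl. destruct (inb x th); congruence.
  - rewrite ren_m_mtc, !bnames_mtc. f_equal. f_equal; auto. f_equal.
    + destruct mu as [s|]; simpl; auto. apply flat_map_map_in. intros [w a] Hin. simpl. eauto.
    + apply flat_map_map_in. intros [a p] Hin. simpl. destruct (H0 a p Hin).
      destruct (inb x th); congruence.
Qed.

(** The binders at the root are kept apart from those further inside, collected by [bin]:
    alpha-conversion at the root changes the former only. *)
Definition bnd (t : term) : list name :=
  match t with Abs th _ _ => th | Mtc _ th _ _ => th | _ => [] end.

Definition bin (t : term) : list name :=
  match t with
  | Abs _ p b => bnames p ++ bnames b
  | Mtc b _ mu D => bnames b ++ flat_map (fun za => bnames (snd za)) (mulist mu)
                    ++ flat_map (fun ap => bnames (fst ap) ++ bnames (snd ap)) D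
  | _ => bnames t
  end.

Lemma bnames_split t : bnames t = bnd t ++ bin t.
Proof. destruct t; auto. apply bnames_mtc. Qed.

Definition ren_bnd (x y : name) (t : term) : term :=
  match t with
  | Abs th p b => Abs (map (rn x y) th) (ren_m x y p) (ren_v x y b)
  | Mtc b th mu D =>
      Mtc (ren_v x y b) (map (rn x y) th)
          (option_map (map (fun za => (rn x y (fst za), snd za))) mu)
          (map (fun ap => (fst ap, ren_m x y (snd ap))) D)
  | _ => t
  end.

Lemma ren_bnd_tequiv x y t : In x (bnd t) -> ~ In y (names t) -> tequiv t (ren_bnd x y t).
Proof. destruct t; simpl; try tauto; intros; apply tequiv_base; now constructor. Qed.

Lemma ren_bnd_bnd x y t : bnd (ren_bnd x y t) = map (rn x y) (bnd t).
Proof. now destruct t. Qed.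

Lemma ren_bnd_bin x y t : bin (ren_bnd x y t) = bin t.
Proof.
  destruct t; auto; simpl; rewrite ?bnames_ren_v, ?bnames_ren_m; auto.
  f_equal. f_equal.
  - destruct mu as [s|]; simpl; auto. now apply flat_map_map_in.
  - apply flat_map_map_in. intros. simpl. now rewrite bnames_ren_m.
Qed.

Lemma in_map_rn x y z th : In z (map (rn x y) th) -> z = y \/ In z th.
Proof.
  intros H. apply in_map_iff in H as (w & <- & H). unfold rn. destruct (w =? x); auto.
Qed.

Lemma ren_bnd_names x y z t : In z (names (ren_bnd x y t)) -> z = y \/ In z (names t).
Proof.
  destruct t as [| | | |th p b|b th mu D]; auto.
  - simpl. rewrite !in_app_iff. intros [H|[H|H]].
    + apply in_map_rn in H. tauto.
    + apply names_ren_m in H. tauto.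
    + apply names_ren_v in H. tauto.
  - unfold ren_bnd. rewrite !names_mtc, !in_app_iff. intros [H|[H|[H|H]]].
    + apply in_map_rn in H. tauto.
    + apply names_ren_v in H. tauto.
    + apply in_flat_map in H as ((w & a) & Hin & Hz). destruct mu as [s|]; simpl in *; [|tauto].
      apply in_map_iff in Hin as ((w' & a') & E & Hin). injection E as <- ->. simpl in Hz.
      assert (Hk : z = y \/ w' = z \/ In z (names a)).
      { unfold rn in Hz. destruct (w' =? x); intuition auto. }
      destruct Hk; auto. right; right; right; left. apply in_flat_map. exists (w', a). auto.
    + apply in_flat_map in H as ((a & p) & Hin & Hz).
      apply in_map_iff in Hin as ((a' & p') & E & Hin). injection E as <- <-. simpl in Hz.
      rewrite in_app_iff in Hz.
      assert (Hk : z = y \/ In z (names a' ++ names p')).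
      { rewrite in_app_iff. destruct Hz as [|Hz]; auto. apply names_ren_m in Hz. tauto. }
      destruct Hk; auto. right; right; right; right. apply in_flat_map. exists (a', p'). auto.
Qed.

(* Binders are renamed one by one, in the order of their positions in the binder list. *)
Lemma freshen_upto t N k : (forall z, In z (names t) -> z < N) ->
  exists t', tequiv t t' /\ bin t' = bin t /\ (forall z, In z (names t') -> z < N + k) /\
    bnd t' = map (fun z => if idx (bnd t) z <? k then N + idx (bnd t) z else z) (bnd t).
Proof.
  intros HN. assert (HB : forall z, In z (bnd t) -> z < N).
  { intros z Hz. apply HN. destruct t; simpl in *; try tauto; rewrite ?in_app_iff; auto. }
  induction k as [|k (t' & Ht & Hi & Hn & Hb)].
  - exists t. repeat split; auto using tequiv_refl.
    + intros z Hz. specialize (HN z Hz). lia.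
    + symmetry. apply map_id.
  - destruct (in_dec Nat.eq_dec k (map (idx (bnd t)) (bnd t))) as [i|i].
    + apply in_map_iff in i as (x & Hx & Hin). exists (ren_bnd x (N + k) t').
      repeat split.
      * eapply tequiv_trans; [exact Ht|]. apply ren_bnd_tequiv.
        -- rewrite Hb. apply in_map_iff. exists x. split; auto. rewrite Hx.
           destruct (Nat.ltb_spec k k); [lia|auto].
        -- intros H. apply Hn in H. lia.
      * now rewrite ren_bnd_bin.
      * intros z Hz. apply ren_bnd_names in Hz as [->|Hz]; [lia|]. apply Hn in Hz. lia.
      * rewrite ren_bnd_bnd, Hb, map_map. apply map_ext_in. intros z Hz.
        destruct (Nat.ltb_spec (idx (bnd t) z) k), (Nat.ltb_spec (idx (bnd t) z) (S k)); try lia.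
        -- apply rn_other. apply HB in Hin. lia.
        -- assert (z = x) as -> by (apply (idx_inj (bnd t)); lia). rewrite rn_same. lia.
        -- apply rn_other. intros ->. lia.
    + exists t'. repeat split; auto.
      * intros z Hz. apply Hn in Hz. lia.
      * rewrite Hb. apply map_ext_in. intros z Hz.
        destruct (Nat.ltb_spec (idx (bnd t) z) k), (Nat.ltb_spec (idx (bnd t) z) (S k)); try lia.
        exfalso. apply i. apply in_map_iff. exists z. split; auto. lia.
Qed.

(** The new binder list depends on [N] and the recorded positions alone, so two terms represented by
    one tree receive literally the same list. *)
Lemma freshen t N : (forall z, In z (names t) -> z < N) ->
  exists t', tequiv t t' /\ bin t' = bin t /\ bnd t' = map (Nat.add N) (map (idx (bnd t)) (bnd t)).
Proof.
  intros HN. destruct (freshen_upto t N (length (bnd t)) HN) as (t' & Ht & Hi & _ & Hb).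
  exists t'. repeat split; auto. rewrite Hb, map_map. apply map_ext_in. intros z Hz.
  pose proof (proj2 (psh_lt (bnd t) id z) Hz) as Hl. fold (idx (bnd t) z) in Hl.
  destruct (Nat.ltb_spec (idx (bnd t) z) (length (bnd t))); lia.
Qed.

Lemma exists_bound (l : list nat) : exists N, forall z, In z l -> z < N.
Proof.
  exists (S (list_max l)). intros z Hz. pose proof (proj1 (list_max_le l (list_max l)) (le_n _)) as H.
  rewrite Forall_forall in H. apply H in Hz. lia.
Qed.

Lemma Forall2_exists {A B} (R : A -> B -> Prop) l :
  (forall x, In x l -> exists y, R x y) -> exists l', Forall2 R l l'.
Proof.
  induction l as [|a l IH]; intros H; [exists []; auto|].
  destruct (H a) as [b Hb]; [now left|]. destruct IH as [l' Hl]; [intros; apply H; now right|].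
  exists (b :: l'). auto.
Qed.

Lemma Forall2_in_r {A B} (R : A -> B -> Prop) l l' y :
  Forall2 R l l' -> In y l' -> exists x, In x l /\ R x y.
Proof.
  induction 1; simpl; [tauto|]. intros [->|Hy]; [eauto|]. destruct IHForall2 as (z & ? & ?); eauto.
Qed.

(** Provides the side condition of [r_subst]. The components are treated inductively; then [top]
    renames the root binders to names beyond those of the term and of [L]. *)
Lemma avoid_bnames L t : exists t', tequiv t t' /\ forall z, In z (bnames t') -> ~ In z L.
Proof.
  assert (top : forall t, (forall z, In z (bin t) -> ~ In z L) ->
            exists t', tequiv t t' /\ forall z, In z (bnames t') -> ~ In z L).
  { intros t' H. destruct (exists_bound (names t' ++ L)) as [N HN].
    destruct (freshen t' N) as (t'' & Ht & Hi & Hb); [intros; apply HN, in_or_app; auto|].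
    exists t''. split; auto. intros z. rewrite bnames_split, in_app_iff, Hi, Hb.
    intros [Hz|Hz]; auto. intros HL. apply in_map_iff in Hz as (w & <- & _).
    specialize (HN (N + w)). rewrite in_app_iff in HN. specialize (HN (or_intror HL)). lia. }
  induction t using term_nested_ind.
  - exists (Var x). split; [apply tequiv_refl|simpl; tauto].
  - exists (Mat x). split; [apply tequiv_refl|simpl; tauto].
  - destruct IHt1 as (u1 & E1 & H1), IHt2 as (u2 & E2 & H2). exists (App u1 u2). split.
    + now apply tequiv_app.
    + simpl. intros z. rewrite in_app_iff. intros [|]; auto.
  - destruct IHt1 as (u1 & E1 & H1), IHt2 as (u2 & E2 & H2). exists (Dat u1 u2). split.
    + now apply tequiv_dat.
    + simpl. intros z. rewrite in_app_iff. intros [|]; auto.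
  - destruct IHt1 as (u1 & E1 & H1), IHt2 as (u2 & E2 & H2).
    destruct (top (Abs th u1 u2)) as (t' & E & H).
    { simpl. intros z. rewrite in_app_iff. intros [|]; auto. }
    exists t'. split; auto. eapply tequiv_trans; [|exact E].
    now apply tequiv_abs.
  - destruct IHt as (b' & Eb & Hb).
    destruct (Forall2_exists (fun ap ap' => (tequiv (fst ap) (fst ap') /\ tequiv (snd ap) (snd ap'))
        /\ forall z, In z (bnames (fst ap') ++ bnames (snd ap')) -> ~ In z L) D) as [D' HD].
    { intros [a p] Hin. destruct (H0 a p Hin) as ((a' & Ea & Ha) & (p' & Ep & Hp)).
      exists (a', p'). simpl. split; auto. intros z. rewrite in_app_iff. intros [|]; auto. }
    destruct (Forall2_exists (fun za za' => (fst za = fst za' /\ tequiv (snd za) (snd za'))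
        /\ forall z, In z (bnames (snd za')) -> ~ In z L) (mulist mu)) as [s' Hs].
    { intros [x a] Hin. destruct (H x a Hin) as (a' & Ea & Ha). exists (x, a'). simpl. auto. }
    destruct (top (Mtc b' th (option_map (fun _ => s') mu) D')) as (t' & E & H').
    { intros z. simpl. rewrite !in_app_iff. intros [Hz|[Hz|Hz]]; auto.
      - destruct mu as [s|]; simpl in *; [|tauto].
        apply in_flat_map in Hz as (x & Hx & Hz). destruct (Forall2_in_r _ _ _ _ Hs Hx) as (? & _ & _ & ?). auto.
      - apply in_flat_map in Hz as (x & Hx & Hz). destruct (Forall2_in_r _ _ _ _ HD Hx) as (? & _ & _ & ?). auto. }
    exists t'. split; auto. eapply tequiv_trans; [|exact E].
    eapply tequiv_trans; [exact (tequiv_compat _ _ _ (compat_mtc_b th mu D) Eb)|].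
    eapply tequiv_trans; [apply (tequiv_mtc_D b' th mu D D') with (D0 := [])|].
    { eapply Forall2_impl; [|exact HD]. simpl. tauto. }
    destruct mu as [s|]; simpl in *; [|apply tequiv_refl].
    apply (tequiv_mtc_mu b' th s s' D') with (s0 := []).
    eapply Forall2_impl; [|exact Hs]. simpl. tauto.
Qed.

(** Injective assignments recover free names from indices, and [freshen] makes the binders at the
    root equal. A match tree represents no named term by itself, so the induction on trees also
    speaks about the terms in its pending pairs and bindings. *)
Lemma Rep_reflects d f g t u : inj f -> inj g -> Rep f g t d -> Rep f g u d -> tequiv t u.
Proof.
  set (Q := fun d => forall f g t u, inj f -> inj g -> Rep f g t d -> Rep f g u d -> tequiv t u).
  assert (H : Q d /\ (forall n a p, In (n, a, p) (pend d) -> Q a /\ Q p)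
                  /\ (forall k a, In (k, a) (binds d) -> Q a)); [|now apply H].
  clear f g t u. induction d; split; try split; simpl; try tauto;
    try match goal with |- Q _ => intros f g t u Hf Hg Ht Hu; destruct t, u; try contradiction end.
  - simpl in *. rewrite (Hf x x0) by congruence. apply tequiv_refl.
  - simpl in *. rewrite (Hg x x0) by congruence. apply tequiv_refl.
  - destruct Ht, Hu, IHd1 as [Q1 _], IHd2 as [Q2 _].
    apply tequiv_app; [apply (Q1 f g)|apply (Q2 f g)]; auto.
  - destruct Ht, Hu, IHd1 as [Q1 _], IHd2 as [Q2 _].
    apply tequiv_dat; [apply (Q1 f g)|apply (Q2 f g)]; auto.
  - destruct (exists_bound (names (Abs th t1 t2) ++ names (Abs th0 u1 u2))) as [N HN].
    destruct (freshen (Abs th t1 t2) N) as (t' & Et & _ & Bt); [intros; apply HN, in_or_app; auto|].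
    destruct (freshen (Abs th0 u1 u2) N) as (u' & Eu & _ & Bu); [intros; apply HN, in_or_app; auto|].
    simpl bnd in Bt, Bu.
    eapply tequiv_trans; [exact Et|]. eapply tequiv_trans; [|apply tequiv_sym; exact Eu].
    assert (Ec : map (idx th) th = map (idx th0) th0) by (destruct Ht, Hu; congruence).
    apply (Rep_tequiv _ _ Et) in Ht. apply (Rep_tequiv _ _ Eu) in Hu.
    destruct t', u'; try contradiction. simpl bnd in Bt, Bu.
    assert (E : th1 = th2) by congruence. destruct E.
    destruct Ht as (_ & Hp & Hb), Hu as (_ & Hp' & Hb'), IHd1 as [Q1 _], IHd2 as [Q2 _].
    apply tequiv_abs; [apply (Q1 f (psh th1 g))|apply (Q2 (psh th1 f) g)]; auto using psh_inj.
  - destruct (exists_bound (names (Mtc t th mu D) ++ names (Mtc u th0 mu0 D0))) as [N HN].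
    destruct (freshen (Mtc t th mu D) N) as (t' & Et & _ & Bt); [intros; apply HN, in_or_app; auto|].
    destruct (freshen (Mtc u th0 mu0 D0) N) as (u' & Eu & _ & Bu); [intros; apply HN, in_or_app; auto|].
    simpl bnd in Bt, Bu.
    eapply tequiv_trans; [exact Et|]. eapply tequiv_trans; [|apply tequiv_sym; exact Eu].
    assert (Ec : map (idx th) th = map (idx th0) th0) by (destruct Ht, Hu; congruence).
    apply (Rep_tequiv _ _ Et) in Ht. apply (Rep_tequiv _ _ Eu) in Hu.
    destruct t', u'; try contradiction. simpl bnd in Bt, Bu.
    assert (E : th1 = th2) by congruence. destruct E. clear Et Eu Bt Bu Ec HN t u th th0 mu mu0 D D0.
    rename t' into b, u' into b', mu1 into mu, mu2 into mu', D1 into D, D2 into D', th1 into th.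
    apply Rep_mtc in Ht as (_ & Hb & _ & Hm & HD), Hu as (_ & Hb' & _ & Hm' & HD').
    destruct IHd1 as [Qb _], IHd2 as (_ & QD & Qm).
    eapply tequiv_trans;
      [apply (tequiv_compat _ _ _ (compat_mtc_b _ _ _) (Qb (psh th f) g b b' (psh_inj th f Hf) Hg Hb Hb'))|].
    destruct (PF2_common (RepP th f g)
                (fun x y => tequiv (fst x) (fst y) /\ tequiv (snd x) (snd y)) D D' (pend d2) HD HD')
      as (D1 & P1 & F1).
    { intros [a p] [a' p'] [[n A] P] Hin (_ & H1 & H2) (_ & H1' & H2'). simpl in *.
      destruct (QD n A P Hin) as [QA QP]. split; [apply (QA f g)|apply (QP f (psh th g))]; auto using psh_inj. }
    eapply tequiv_trans; [apply tequiv_base, eq_perm_D, P1|].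
    eapply tequiv_trans; [apply (tequiv_mtc_D b' th mu D1 D' F1 [])|]. simpl.
    destruct mu as [s|], mu' as [s'|]; simpl in Hm, Hm'; try tauto; [|apply tequiv_refl].
    destruct (PF2_common (RepB th f g)
                (fun x y => fst x = fst y /\ tequiv (snd x) (snd y)) s s' (binds d2) (proj2 Hm) (proj2 Hm'))
      as (s1 & P2 & F2).
    { intros [z a] [z' a'] [k A] Hin (H1 & H2) (H1' & H2'). simpl in *.
      split; [|apply (Qm k A Hin f g); auto]. apply (idx_inj th). congruence. }
    eapply tequiv_trans; [apply tequiv_base, eq_perm_mu, P2|].
    apply (tequiv_mtc_mu b' th s1 s' D' F2 []).
  - intros n' a p [E|[]]. injection E as <- <- <-. tauto.
  - intros k' a [E|[]]. injection E as <- <-. tauto.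
  - intros n a p. rewrite in_app_iff. destruct IHd1 as (_ & H1 & _), IHd2 as (_ & H2 & _). intros [|]; eauto.
  - intros k a. rewrite in_app_iff. destruct IHd1 as (_ & _ & H1), IHd2 as (_ & _ & H2). intros [|]; eauto.
Qed.

Lemma wf_mtc b th mu D : wf (Mtc b th mu D) ->
  wf b /\ match mu with None => True | Some s => NoDup (map fst s) end /\
  (forall x a, In (x, a) (mulist mu) -> wf a) /\ (forall a p, In (a, p) D -> wf a /\ wf p).
Proof.
  simpl. intros (Hb & Hm & HD). split; [|split; [|split]]; auto.
  - destruct mu; tauto.
  - intros x a. destruct mu as [s|]; simpl; [|tauto]. destruct Hm as [_ Hm].
    induction s as [|[y c] s IH]; simpl; [tauto|]. destruct Hm. intros [E|E]; auto. now injection E as <- <-.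
  - intros a p. induction D as [|[c q] D IH]; simpl; [tauto|]. destruct HD as (? & ? & ?).
    intros [E|E]; auto. now injection E as <- <-.
Qed.

Lemma PF2_keys th f g s S : PF2 (RepB th f g) s S -> Permutation (map (idx th) (map fst s)) (map fst S).
Proof.
  intros (S' & HP & HF)%PF2_spec. rewrite <- HP. clear HP.
  induction HF as [|za ka s S' [E _] HF IH]; simpl; auto. rewrite E. now constructor.
Qed.

Lemma NoDup_idx th l : NoDup (map (idx th) l) <-> NoDup l.
Proof.
  split; [apply NoDup_map_inv|]. apply FinFun.Injective_map_NoDup. exact (idx_inj th).
Qed.

(** Pairs and bindings are lined up in combs that end in [TOk]. The distinct keys granted by [wf]
    keep the tree of a substitution from failing; a bottom match gets a leaf [TFail] beside its
    pairs. *)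
Lemma Rep_exists t : wf t -> forall f g, exists d, Rep f g t d.
Proof.
  induction t using term_nested_ind; intros Hw f g.
  - exists (TV (f x)). reflexivity.
  - exists (TM (g x)). reflexivity.
  - destruct Hw as [W1 W2], (IHt1 W1 f g) as [d1 H1], (IHt2 W2 f g) as [d2 H2]. now exists (TApp d1 d2).
  - destruct Hw as [W1 W2], (IHt1 W1 f g) as [d1 H1], (IHt2 W2 f g) as [d2 H2]. now exists (TDat d1 d2).
  - destruct Hw as [W1 W2], (IHt1 W1 f (psh th g)) as [d1 H1], (IHt2 W2 (psh th f) g) as [d2 H2].
    now exists (TAbs (map (idx th) th) d1 d2).
  - apply wf_mtc in Hw as (Wb & ND & Wm & WD). destruct (IHt Wb (psh th f) g) as [d Hd].
    assert (HD : exists m, wsm m = true /\ fl m = false /\ binds m = [] /\ PF2 (RepP th f g) D (pend m)).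
    { clear - H0 WD. induction D as [|[a p] D IH]; [now exists TOk|].
      destruct IH as (m & E1 & E2 & E3 & HP); [intros; apply H0; now right|intros; apply WD; now right|].
      destruct (H0 a p) as [Ha Hp]; [now left|]. destruct (WD a p) as [Wa Wp]; [now left|].
      destruct (Ha Wa f g) as [A HA], (Hp Wp f (psh th g)) as [P HP'].
      exists (TNode (TPend (length th) A P) m). simpl. rewrite E1, E2, E3. repeat split; auto.
      exists [], (length th, A, P), (pend m). repeat split; auto. }
    assert (Hm : exists m, wsm m = true /\ fl m = false /\ pend m = [] /\ PF2 (RepB th f g) (mulist mu) (binds m)).
    { clear - H Wm. induction (mulist mu) as [|[x a] s IH]; [now exists TOk|].
      destruct IH as (m & E1 & E2 & E3 & HP);
        [intros y e Hy; apply (H y e); now right|intros y e Hy; apply (Wm y e); now right|].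
      destruct (H x a (or_introl eq_refl) (Wm x a (or_introl eq_refl)) f g) as [A HA].
      exists (TNode (TBnd (idx th x) A) m). simpl. rewrite E1, E2, E3. repeat split; auto.
      exists [], (idx th x, A), (binds m). repeat split; auto. }
    destruct HD as (m1 & W1 & F1 & B1 & P1), Hm as (m2 & W2 & F2 & P2 & B2).
    destruct mu as [s|].
    + exists (TMtc (map (idx th) th) d (TNode m1 m2)). apply Rep_mtc. unfold RepMu, failing, keys.
      simpl. rewrite W1, W2, F1, F2, B1, P2, app_nil_r. simpl. repeat split; auto.
      intros [E|E]; [discriminate|]. apply E. apply (Permutation_NoDup (PF2_keys _ _ _ _ _ B2)).
      now apply NoDup_idx.
    + exists (TMtc (map (idx th) th) d (TNode TFail m1)). apply Rep_mtc. unfold RepMu, failing.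
      simpl. rewrite W1. repeat split; auto.
Qed.

(** * Substitution and decided matches *)

(** On pure terms a representation can be computed; this supplies the tree [bt] of bottom. *)
Fixpoint enc (f g : name -> nat) (t : term) : tm :=
  match t with
  | Var x => TV (f x)
  | Mat x => TM (g x)
  | App t u => TApp (enc f g t) (enc f g u)
  | Dat t u => TDat (enc f g t) (enc f g u)
  | Abs th p b => TAbs (map (idx th) th) (enc f (psh th g) p) (enc (psh th f) g b)
  | Mtc _ _ _ _ => TOk
  end.

Lemma Rep_enc t : pure t -> forall f g, Rep f g t (enc f g t).
Proof. induction t; simpl; intuition auto. Qed.

Lemma sub_enc t : pure t -> forall f g s q,
  (forall x, In x (fv t) -> s (f x) = TV (f x)) -> (forall x, In x (fm t) -> q (g x) = g x) ->
  sub s q (enc f g t) = enc f g t.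
Proof.
  induction t; simpl; intros Hp f g s q Hs Hq; try tauto.
  - apply Hs. auto.
  - f_equal. apply Hq. auto.
  - destruct Hp. f_equal; [apply IHt1|apply IHt2]; auto using in_or_app.
  - destruct Hp. rewrite length_map. f_equal; [apply IHt1|apply IHt2]; auto.
    + intros x Hx. unfold upm. rewrite Hs; auto using in_or_app.
    + intros x Hx. destruct (in_dec Nat.eq_dec x th).
      * apply up_lt. now apply psh_lt.
      * rewrite psh_notin, up_add, Hq; auto. apply in_or_app. left. now apply in_filter_out.
    + intros x Hx. destruct (in_dec Nat.eq_dec x th).
      * apply upv_lt. now apply psh_lt.
      * rewrite psh_notin, upv_add, Hs; auto. apply in_or_app. right. now apply in_filter_out.
    + intros x Hx. apply Hq. auto using in_or_app.
Qed.

Lemma lookup_notin x s : ~ In x (map fst s) -> lookup x s = None.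
Proof.
  induction s as [|[z a] s IH]; simpl; auto. intros H. destruct (Nat.eqb_spec x z); [|tauto].
  subst. tauto.
Qed.

Lemma lookup_in x s : In x (map fst s) -> exists a, lookup x s = Some a /\ In (x, a) s.
Proof.
  induction s as [|[z a] s IH]; simpl; [tauto|]. intros H. destruct (Nat.eqb_spec x z) as [->|n].
  - eauto.
  - destruct IH as (c & ? & ?); [intuition congruence|]. eauto.
Qed.

Lemma look_in k a S : NoDup (map fst S) -> In (k, a) S -> look k S = a.
Proof.
  induction S as [|[j c] S IH]; simpl; [tauto|]. intros HN [E|H].
  - injection E as -> ->. now rewrite Nat.eqb_refl.
  - inversion HN; subst. destruct (Nat.eqb_spec k j) as [->|]; auto.
    destruct H2. now apply (in_map fst) in H.
Qed.

Lemma subst_var_restrict th s x :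
  subst (restrict th s) (Var x) = if inb x th then Var x else subst s (Var x).
Proof.
  simpl. induction s as [|[z a] s IH]; simpl; [now destruct (inb x th)|].
  destruct (Nat.eqb_spec x z) as [<-|n]; destruct (inb x th) eqn:E1; simpl.
  - apply IH.
  - now rewrite Nat.eqb_refl.
  - destruct (inb z th); simpl; auto. destruct (Nat.eqb_spec x z); tauto.
  - destruct (inb z th); simpl; auto. destruct (Nat.eqb_spec x z); tauto.
Qed.

Definition nocap (l : list name) (s : list (name * term)) : Prop :=
  forall z, In z l -> ~ In z (flat_map fn (map snd s)).

Lemma subst_var_fn s x z : In z (fn (subst s (Var x))) -> In z (flat_map fn (map snd s)) \/ subst s (Var x) = Var x.
Proof.
  simpl. induction s as [|[y a] s IH]; simpl; auto. destruct (x =? y).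
  - rewrite in_app_iff. auto.
  - rewrite in_app_iff. intros H. destruct (IH H); auto.
Qed.

Lemma nocap_restrict l th s : nocap l s -> nocap l (restrict th s).
Proof.
  intros H z Hz Hf. apply (H z Hz). apply in_flat_map in Hf as (a & Ha & Hf). apply in_flat_map.
  exists a. split; auto. apply in_map_iff in Ha as (q & <- & Hq). apply in_map.
  now apply filter_In in Hq.
Qed.

(** Images are compared through [subst s (Var x)], which covers replaced and untouched variables
    alike and so passes under binders: restricting [s] corresponds to lifting [sg]. By [nocap] no
    free name of a substituted term is bound on the way, so shifting its indices is correct. *)
Lemma Rep_subst t : forall f g f' s sg d, Rep f g t d -> nocap (bnames t) s ->
  (forall x, Rep f' g (subst s (Var x)) (sg (f x))) -> Rep f' g (subst s t) (sub sg id d).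
Proof.
  assert (Hm : forall th f g f' s sg, nocap th s -> (forall x, Rep f' g (subst s (Var x)) (sg (f x))) ->
             forall x, Rep f' (psh th g) (subst s (Var x)) (upm (length th) sg (f x))).
  { intros th f g f' s sg Hc H x. unfold upm. eapply Rep_ext; [apply Rep_ren, H| |].
    - auto.
    - intros z Hz. symmetry. apply psh_notin. intros Hin.
      destruct (subst_var_fn s x z) as [Hf|Hf]; [unfold fn; apply in_or_app; auto|now apply (Hc z)|].
      rewrite Hf in Hz. exact Hz. }
  assert (Hv : forall th f g f' s sg, nocap th s -> (forall x, Rep f' g (subst s (Var x)) (sg (f x))) ->
             forall x, Rep (psh th f') g (subst (restrict th s) (Var x)) (upv (length th) sg (psh th f x))).
  { intros th f g f' s sg Hc H x. rewrite subst_var_restrict. destruct (inb_spec x th) as [i|i].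
    - rewrite upv_lt by now apply psh_lt. now apply psh_in.
    - rewrite psh_notin, upv_add by assumption. eapply Rep_ext; [apply Rep_ren, H| |auto].
      intros z Hz. symmetry. apply psh_notin. intros Hin.
      destruct (subst_var_fn s x z) as [Hf|Hf]; [unfold fn; apply in_or_app; auto|now apply (Hc z)|].
      rewrite Hf in Hz. destruct Hz as [<-|[]]. auto. }
  assert (Ha : forall l1 l2 s, nocap (l1 ++ l2) s -> nocap l1 s /\ nocap l2 s).
  { intros l1 l2 s H. split; intros z Hz; apply H, in_or_app; auto. }
  induction t using term_nested_ind; intros f g f' s sg d HR Hc Hs; inv_rep HR.
  - simpl in HR. subst. apply Hs.
  - exact HR.
  - destruct HR. apply Ha in Hc as []. simpl. eauto.
  - destruct HR. apply Ha in Hc as []. simpl. eauto.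
  - destruct HR as (-> & Hp & Hb). apply Ha in Hc as [Hct Hc]. apply Ha in Hc as [Hcp Hcb].
    simpl. rewrite length_map, up_id. split; [|split]; auto.
    + eapply IHt1; eauto.
    + eapply IHt2; eauto using nocap_restrict.
  - apply Rep_mtc in HR as (-> & Hb & W & HM & HD). rewrite bnames_mtc in Hc.
    apply Ha in Hc as [Hct Hc]. apply Ha in Hc as [Hcb Hc]. apply Ha in Hc as [Hcm HcD].
    rewrite subst_mtc. cbn [sub]. apply Rep_mtc.
    destruct (wsm_sub sg id d2 W) as (E1 & E2 & E3 & E4).
    rewrite length_map, E1, E4. split; [|split; [|split; [|split]]]; auto.
    + eapply IHt; eauto using nocap_restrict.
    + assert (Ek : keys (sub sg id d2) = keys d2) by (unfold keys; rewrite E3; apply map_fst_snd_map).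
      pose proof (failing_map d2 (sub sg id d2) E2 Ek) as F.
      destruct mu as [s0|]; simpl in *; rewrite F; auto.
      destruct HM as [HM1 HM2]. split; auto. rewrite E3.
      eapply PF2_map; eauto. intros [z a] ka Hin _ [E Hz]. split; auto. simpl in *.
      eapply H; eauto. intros w Hw. apply Hcm. apply in_flat_map. exists (z, a). auto.
    + eapply PF2_map; eauto. intros [a p] [[n A] P] Hin _ (En & Ea & Ep).
      destruct (H0 a p Hin) as [HA HP]. simpl in *. subst n. split; [|split]; simpl; auto.
      * eapply HA; eauto. intros w Hw. apply HcD. apply in_flat_map. exists (a, p). split; auto. simpl. auto using in_or_app.
      * rewrite up_id. eapply HP; eauto. intros w Hw. apply HcD. apply in_flat_map. exists (a, p). split; auto. simpl. auto using in_or_app.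
Qed.

Lemma PF2_in {A B} (R : A -> B -> Prop) l m x : PF2 R l m -> In x l -> exists y, In y m /\ R x y.
Proof.
  intros (m' & HP & HF)%PF2_spec Hx. apply Forall2_flip in HF.
  destruct (Forall2_in_r _ _ _ _ HF Hx) as (y & Hy & HR). exists y. split; auto. eapply Permutation_in; eauto.
Qed.

(** Distinct keys make [look] independent of the order of [S], which [PF2] leaves open. The
    condition on the domain ensures that every name of [th] finds its term and that other names are
    left alone. *)
Lemma Rep_inst b th f g B s S : Rep (psh th f) g b B -> PF2 (RepB th f g) s S -> NoDup (map fst S) ->
  same_set (map fst s) th -> nocap (bnames b) s -> Rep f g (subst s b) (sub (inst (length th) S) id B).
Proof.
  intros Hb HS HN Hth Hc. eapply Rep_subst; eauto. intros x. unfold inst.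
  destruct (in_dec Nat.eq_dec x th) as [i|i].
  - destruct (psh_in th f id x i) as [Hl E]. destruct (Nat.ltb_spec (psh th f x) (length th)); [|lia].
    apply Hth in i. destruct (lookup_in x s i) as (a & Ea & Hin).
    destruct (PF2_in _ _ _ _ HS Hin) as ([k A] & HkA & Ek & HA). simpl in *.
    rewrite Ea, E. unfold idx in Ek. rewrite Ek, (look_in k A); auto.
  - rewrite psh_notin by assumption. destruct (Nat.ltb_spec (length th + f x) (length th)); [lia|].
    simpl. rewrite lookup_notin by (intros Hx; now apply i, Hth). simpl. lia.
Qed.

(** * Disjoint union of decided matches and failure *)

Lemma dunion_nil mu : dunion mu (Some []) = mu.
Proof.
  destruct mu as [s|]; simpl; auto. rewrite app_nil_r.
  replace (existsb _ _) with false; auto. symmetry. induction (map fst s); auto.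
Qed.

Lemma dunion_some s1 s2 : (dunion (Some s1) (Some s2) = Some (s1 ++ s2) /\
    forall x, In x (map fst s1) -> ~ In x (map fst s2)) \/
  (dunion (Some s1) (Some s2) = None /\ exists x, In x (map fst s1) /\ In x (map fst s2)).
Proof.
  simpl. destruct (existsb _ _) eqn:E.
  - right. split; auto. apply existsb_exists in E as (x & H1 & H2). exists x. split; auto.
    now destruct (inb_spec x (map fst s2)).
  - left. split; auto. intros x H1 H2.
    assert (existsb (fun x => inb x (map fst s2)) (map fst s1) = true) as E'; [|congruence].
    apply existsb_exists. exists x. split; auto. now destruct (inb_spec x (map fst s2)).
Qed.

Lemma NoDup_app_iff {A} (l1 l2 : list A) :
  NoDup (l1 ++ l2) <-> NoDup l1 /\ NoDup l2 /\ forall x, In x l1 -> ~ In x l2.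
Proof.
  induction l1 as [|a l1 IH]; simpl.
  - split; [intros; repeat split; auto using NoDup_nil|tauto].
  - rewrite !NoDup_cons_iff, IH, in_app_iff. split.
    + intros (H1 & H2 & H3 & H4). repeat split; auto. intros x [<-|Hx]; auto.
    + intros ((H1 & H2) & H3 & H4). repeat split; auto. intros [H|H]; auto. apply (H4 a); auto.
Qed.

(** Think of [m'] as [m] with the decided content of [m1] grafted into it. The disjuncts are the
    ways a disjoint union becomes bottom: one side is bottom, or a key is shared. *)
Lemma failing_union m m1 m' : fl m' = fl m || fl m1 -> Permutation (binds m') (binds m ++ binds m1) ->
  failing m' <-> failing m \/ failing m1 \/ exists k, In k (keys m) /\ In k (keys m1).
Proof.
  unfold failing, keys. intros Hf HP. rewrite Hf, orb_true_iff.
  assert (E : NoDup (map fst (binds m')) <-> NoDup (map fst (binds m) ++ map fst (binds m1))).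
  { rewrite <- map_app. split; apply Permutation_NoDup, Permutation_map; [|symmetry]; auto. }
  rewrite E, NoDup_app_iff. clear.
  assert (D : forall l l' : list nat, (exists k, In k l /\ In k l') \/ forall k, In k l -> ~ In k l').
  { intros l l'. destruct (Exists_dec (fun k => In k l') l (fun k => in_dec Nat.eq_dec k l')) as [e|e].
    - left. now apply Exists_exists in e.
    - right. intros k Hk Hk'. apply e, Exists_exists. eauto. }
  destruct (D (map fst (binds m)) (map fst (binds m1))) as [(k & H1 & H2)|H].
  - split; [intros _; right; right; exists k; auto|]. intros _. right. intros (_ & _ & H3). now apply (H3 k).
  - split; [|intros [[?|?]|[[?|?]|(k & H1 & H2)]]; auto; right; intros (? & ? & ?); auto; now apply (H k)].
    intros [[?|?]|Hn]; auto.
    destruct (NoDup_dec Nat.eq_dec (map fst (binds m))); auto.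
    destruct (NoDup_dec Nat.eq_dec (map fst (binds m1))); auto. tauto.
Qed.

(** Disjoint union corresponds to mere juxtaposition in the tree; injectivity of [idx] makes a clash
    of names the same as a clash of keys. *)
Lemma RepMu_dunion th f g mu o m m1 m' : RepMu th f g mu m -> RepMu th f g o m1 ->
  fl m' = fl m || fl m1 -> Permutation (binds m') (binds m ++ binds m1) ->
  RepMu th f g (dunion mu o) m'.
Proof.
  intros H1 H2 Hf HP. pose proof (failing_union m m1 m' Hf HP) as HF.
  destruct mu as [s|]; [|apply HF; auto]. destruct o as [s1|]; [|apply HF; auto].
  destruct H1 as [N1 P1], H2 as [N2 P2].
  pose proof (PF2_keys _ _ _ _ _ P1) as K1. pose proof (PF2_keys _ _ _ _ _ P2) as K2.
  destruct (dunion_some s s1) as [[-> HD]|[-> (x & Hx1 & Hx2)]].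
  - split.
    + rewrite HF. intros [?|[?|(k & Hk1 & Hk2)]]; auto.
      unfold keys in *. rewrite <- K1 in Hk1. rewrite <- K2 in Hk2.
      apply in_map_iff in Hk1 as (x & Ex & Hx), Hk2 as (y & Ey & Hy).
      assert (x = y) as -> by (apply (idx_inj th); congruence). now apply (HD y).
    + eapply PF2_perm; [reflexivity|symmetry; exact HP|]. now apply PF2_app.
  - apply HF. right; right. exists (idx th x). unfold keys. rewrite <- K1, <- K2. auto using in_map.
Qed.

Lemma failb_failure th f g a p A P : inj g -> RepP th f g (a, p) (length th, A, P) ->
  failb (length th) A P = true -> failure th a p.
Proof.
  intros Hg (_ & Ha & Hp) F. simpl in *. destruct P; try discriminate; destruct p; try contradiction.
  - simpl in *. subst i. apply andb_prop in F as [F1 F2]. apply Nat.leb_le in F1.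
    assert (Hx : ~ In x th) by (intros Hx; apply (psh_lt th g) in Hx; lia).
    destruct A; try discriminate; destruct a; try contradiction; constructor; auto.
    intros ->. simpl in Ha. rewrite psh_notin, Ha, Nat.eqb_refl in F2; [discriminate|auto].
  - destruct A; try discriminate; destruct a; try contradiction; constructor.
  - constructor.
Qed.

Lemma failure_failb th f g a p A P : inj g -> RepP th f g (a, p) (length th, A, P) ->
  failure th a p -> failb (length th) A P = true.
Proof.
  intros Hg (_ & Ha & Hp) F. simpl in *.
  destruct F; destruct P; try contradiction; try (destruct A; try contradiction; simpl; auto; fail).
  - destruct A; try contradiction. simpl in *. subst. rewrite psh_notin by assumption.
    destruct (Nat.leb_spec (length th) (length th + g x)); [|lia]. simpl.
    destruct (Nat.eqb_spec (length th + g x) (length th + g y)); auto. destruct H0. apply Hg. lia.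
  - destruct A; try contradiction. simpl in *. subst. rewrite psh_notin by assumption.
    destruct (Nat.leb_spec (length th) (length th + g x)); auto; lia.
  - destruct A; try contradiction. simpl in *. subst. rewrite psh_notin by assumption.
    destruct (Nat.leb_spec (length th) (length th + g x)); auto; lia.
Qed.

Lemma same_set_idx th l S : Permutation (map (idx th) l) S ->
  same_set S (map (idx th) th) <-> same_set l th.
Proof.
  intros HP. unfold same_set. split; intros H z.
  - specialize (H (idx th z)).
    assert (E : forall l', In (idx th z) (map (idx th) l') <-> In z l').
    { intros l'. rewrite in_map_iff. split; [|eauto]. intros (x & E & Hx). now apply idx_inj in E as <-. }
    rewrite <- HP, !E in H. exact H.
  - rewrite <- HP, !in_map_iff. split; intros (x & E & Hx); exists x; split; auto; now apply H.
Qed.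

(** * Simulations between named terms and trees *)

Lemma PF2_single {A B} (R : A -> B -> Prop) D q : PF2 R D [q] -> exists x, D = [x] /\ R x q.
Proof.
  intros (m' & HP & HF)%PF2_spec. symmetry in HP. apply Permutation_length_1_inv in HP as ->.
  inversion HF as [|x y D' l Hx HF' E1 E2]; subst. inversion HF'; subst. eauto.
Qed.

Lemma PF2_nil_r {A B} (R : A -> B -> Prop) D : PF2 R D [] -> D = [].
Proof. destruct D; auto. intros (m1 & b & m2 & E & _). now destruct m1. Qed.

Lemma PF2_NoDup th f g s S : PF2 (RepB th f g) s S -> NoDup (map fst S) <-> NoDup (map fst s).
Proof.
  intros H%PF2_keys. rewrite <- (NoDup_idx th). split; apply Permutation_NoDup; [symmetry|]; exact H.
Qed.

Lemma RepMu_nil th f g m : fl m = false -> binds m = [] -> RepMu th f g (Some []) m.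
Proof.
  intros Hf Hb. simpl. unfold failing, keys. rewrite Hf, Hb. split; auto.
  intros [?|H]; [discriminate|]. apply H, NoDup_nil.
Qed.

Lemma dunion_assoc m1 m2 m3 : dunion (dunion m1 m2) m3 = dunion m1 (dunion m2 m3).
Proof.
  assert (E : forall l l' k : list name,
    existsb (fun x => inb x (l ++ l')) k = existsb (fun x => inb x l) k || existsb (fun x => inb x l') k).
  { intros l l' k. induction k as [|x k IH]; simpl; auto. rewrite IH.
    replace (inb x (l ++ l')) with (inb x l || inb x l') by (symmetry; apply existsb_app).
    generalize (inb x l) (inb x l') (existsb (fun x => inb x l) k) (existsb (fun x => inb x l') k).
    now intros [] [] [] []. }
  destruct m1 as [s1|], m2 as [s2|], m3 as [s3|]; simpl; auto; try now destruct (existsb _ _).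
  destruct (existsb (fun x => inb x (map fst s2)) (map fst s1)) eqn:E12;
  destruct (existsb (fun x => inb x (map fst s3)) (map fst s2)) eqn:E23; simpl; auto;
    rewrite !map_app, ?existsb_app, ?E, ?E12, ?E23, ?orb_true_r, ?orb_false_r; simpl; auto.
  now rewrite <- app_assoc.
Qed.

Lemma dunion_rn x y mu a w : (forall z, In z (map fst (mulist mu)) -> z <> y) -> w <> y ->
  let h := map (fun za : name * term => (rn x y (fst za), snd za)) in
  dunion (option_map h mu) (Some [(rn x y w, a)]) = option_map h (dunion mu (Some [(w, a)])).
Proof.
  intros Hm Hw h. destruct mu as [s|]; auto. simpl in Hm. cbn [option_map dunion map fst].
  replace (existsb (fun z => inb z [rn x y w]) (map fst (h s)))
    with (existsb (fun z => inb z [w]) (map fst s)).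
  - destruct (existsb _ _); cbn [option_map]; auto. unfold h. now rewrite map_app.
  - clear a. induction s as [|[z a] s IH]; simpl in *; auto. rewrite IH by auto. f_equal.
    rewrite !orb_false_r. specialize (Hm z (or_introl eq_refl)). unfold rn.
    destruct (Nat.eqb_spec z x), (Nat.eqb_spec w x), (Nat.eqb_spec z w);
      symmetry; rewrite ?Nat.eqb_eq, ?Nat.eqb_neq; congruence.
Qed.

Lemma filter_rn_le (P : name -> bool) x y l : P y = false ->
  length (filter P (map (rn x y) l)) <= length (filter P l).
Proof.
  intros Hy. induction l as [|z l IH]; simpl; auto. unfold rn at 1. destruct (z =? x).
  - rewrite Hy. destruct (P z); simpl; lia.
  - destruct (P z); simpl; lia.
Qed.

(** The measure for [step_bind], where [P] singles out the binder entries that are free in the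
    argument. *)
Lemma filter_rn_lt (P : name -> bool) x y l : P y = false -> P x = true -> In x l ->
  length (filter P (map (rn x y) l)) < length (filter P l).
Proof.
  intros Hy Hx. induction l as [|z l IH]; simpl; [tauto|]. intros [->|Hin].
  - rewrite rn_same, Hx, Hy. simpl. pose proof (filter_rn_le P x y l Hy). lia.
  - specialize (IH Hin). unfold rn at 1. destruct (z =? x).
    + rewrite Hy. destruct (P z); simpl; lia.
    + destruct (P z); simpl; lia.
Qed.

(* The side condition of [r_bind] always holds up to renaming of the binder. *)
Lemma step_bind bot a th : forall b mu x D, In x th ->
  step bot (Mtc b th mu ((a, Mat x) :: D)) (Mtc b th (dunion mu (Some [(x, a)])) D).
Proof.
  remember (length (filter (fun z => inb z (fn a)) th)) as k eqn:Ek.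
  revert th Ek. induction k as [k IH] using lt_wf_ind. intros th -> b mu x D Hx.
  destruct (Exists_dec (fun z => In z (fn a)) th (fun z => in_dec Nat.eq_dec z (fn a))) as [e|e].
  - apply Exists_exists in e as (z & Hz & Ha).
    set (t := Mtc b th mu ((a, Mat x) :: D)). set (u := Mtc b th (dunion mu (Some [(x, a)])) D).
    destruct (exists_bound (names t ++ names u ++ fn a)) as [y Hy].
    assert (Hyt : ~ In y (names t)) by (intros H; apply (Nat.lt_irrefl y), Hy; rewrite !in_app_iff; auto).
    assert (Hyu : ~ In y (names u)) by (intros H; apply (Nat.lt_irrefl y), Hy; rewrite !in_app_iff; auto).
    assert (Hya : ~ In y (fn a)) by (intros H; apply (Nat.lt_irrefl y), Hy; rewrite !in_app_iff; auto).
    (* The argument [a] is outside the scope of the binder and is not renamed, so fewer binder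
       entries are free in it. By [dunion_rn] the renaming commutes with adding the binding, so both
       ends are converted together. *)
    assert (S : step bot (ren_bnd z y t) (ren_bnd z y u)).
    { unfold t, u. simpl. unfold t in Hyt. rewrite names_mtc, !in_app_iff in Hyt. simpl in Hyt.
      rewrite <- dunion_rn.
      - eapply IH; [|reflexivity|].
        + apply filter_rn_lt; auto; now destruct (inb_spec y (fn a)), (inb_spec z (fn a)).
        + apply in_map_iff. eauto.
      - intros w Hw ->. apply Hyt. right; right; left. apply in_map_iff in Hw as (q & <- & Hq).
        apply in_flat_map. exists q. simpl. auto.
      - intros ->. tauto. }
    destruct S as (t1 & u1 & E1 & S & E2). exists t1, u1. split; [|split]; auto.
    + eapply tequiv_trans; [|exact E1]. now apply ren_bnd_tequiv.
    + eapply tequiv_trans; [exact E2|]. apply tequiv_sym. now apply ren_bnd_tequiv.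
  - eexists _, _. split; [apply tequiv_refl|]. split; [|apply tequiv_refl]. apply ctx_base, r_bind; auto.
    intros z Hz Hth. apply e, Exists_exists. eauto.
Qed.

(** * From named steps to parallel steps *)

Section Simulation.
Variables (bot : term) (bt : tm).
Hypothesis bt_rep : forall f g, Rep f g bot bt.

(** Replaces one pending leaf by [m1]. [R] is the remaining Delta; contents are described up to
    permutation, which is all that [Rep] observes. *)
Lemma par_pend_in m n a p m1 : wsm m = true -> In (n, a, p) (pend m) ->
  par bt (TPend n a p) m1 -> wsm m1 = true ->
  exists m' R, par bt m m' /\ wsm m' = true /\ Permutation (pend m) ((n, a, p) :: R) /\
    Permutation (pend m') (pend m1 ++ R) /\ Permutation (binds m') (binds m ++ binds m1) /\
    fl m' = fl m || fl m1.
Proof.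
  intros W Hin HP W1. induction m; simpl in *; try tauto.
  - destruct Hin as [E|[]]. injection E as -> -> ->. exists m1, [].
    rewrite app_nil_r. repeat split; auto.
  - apply andb_prop in W as [Wl Wr]. apply in_app_or in Hin as [Hin|Hin].
    + destruct (IHm1 Wl Hin) as (m' & R & P' & W' & E1 & E2 & E3 & E4).
      exists (TNode m' m3), (R ++ pend m3). simpl. rewrite W', Wr, E4. repeat split.
      * constructor; auto. apply par_refl.
      * now rewrite E1.
      * now rewrite E2, app_assoc.
      * rewrite E3, <- !app_assoc. apply Permutation_app_head, Permutation_app_comm.
      * rewrite <- !orb_assoc. f_equal. apply orb_comm.
    + destruct (IHm2 Wr Hin) as (m' & R & P' & W' & E1 & E2 & E3 & E4).
      exists (TNode m2 m'), (pend m2 ++ R). simpl. rewrite W', Wl, E4. repeat split.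
      * constructor; auto. apply par_refl.
      * rewrite E1. symmetry. apply Permutation_middle.
      * rewrite E2, !app_assoc. apply Permutation_app_tail, Permutation_app_comm.
      * now rewrite E3, app_assoc.
      * apply orb_assoc.
Qed.

Lemma par_bind_in m k a a' : wsm m = true -> In (k, a) (binds m) -> par bt a a' ->
  exists m' R, par bt m m' /\ wsm m' = true /\ pend m' = pend m /\ fl m' = fl m /\
    Permutation (binds m) ((k, a) :: R) /\ Permutation (binds m') ((k, a') :: R).
Proof.
  intros W Hin HP. induction m; simpl in *; try tauto.
  - destruct Hin as [E|[]]. injection E as -> ->. exists (TBnd k a'), []. repeat split; auto. now constructor.
  - apply andb_prop in W as [Wl Wr]. apply in_app_or in Hin as [Hin|Hin].
    + destruct (IHm1 Wl Hin) as (m' & R & P' & W' & E1 & E2 & E3 & E4).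
      exists (TNode m' m2), (R ++ binds m2). simpl. rewrite W', Wr, E1, E2. repeat split.
      * constructor; auto. apply par_refl.
      * now rewrite E3.
      * now rewrite E4.
    + destruct (IHm2 Wr Hin) as (m' & R & P' & W' & E1 & E2 & E3 & E4).
      exists (TNode m1 m'), (binds m1 ++ R). simpl. rewrite W', Wl, E1, E2. repeat split.
      * constructor; auto. apply par_refl.
      * rewrite E3. symmetry. apply Permutation_middle.
      * rewrite E4. symmetry. apply Permutation_middle.
Qed.

(** The common shape of all rules acting on one pair: it leaves the pairs [D'] and contributes [o]
    to the decided match, with [Some []] for no contribution and [None] for a failure. *)
Lemma Rep_leaf f g b th mu D1 a p D2 c B m D' o :
  Rep f g (Mtc b th mu (D1 ++ (a, p) :: D2)) (TMtc c B m) ->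
  (forall A P, RepP th f g (a, p) (length th, A, P) -> exists m1,
     par bt (TPend (length th) A P) m1 /\ wsm m1 = true /\
     PF2 (RepP th f g) D' (pend m1) /\ RepMu th f g o m1) ->
  exists m', par bt (TMtc c B m) (TMtc c B m') /\
    Rep f g (Mtc b th (dunion mu o) (D' ++ D1 ++ D2)) (TMtc c B m').
Proof.
  intros (Hc & Hb & W & HM & HD)%Rep_mtc H.
  apply PF2_mid in HD as (P1 & [[n A] P] & P2 & EP & HA & HD).
  pose proof (proj1 HA) as En. simpl in En. subst n.
  destruct (H A P HA) as (m1 & Hp & W1 & HP1 & HM1).
  destruct (par_pend_in m (length th) A P m1) as (m' & R & Hp' & W' & E1 & E2 & E3 & E4); auto.
  { rewrite EP. apply in_elt. }
  exists m'. split; [constructor; auto; apply par_refl|].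
  apply Rep_mtc. split; [|split; [|split; [|split]]]; auto.
  - eapply RepMu_dunion; eauto.
  - apply (PF2_perm _ (D' ++ D1 ++ D2) _ (pend m1 ++ P1 ++ P2) _); auto.
    + rewrite E2. apply Permutation_app_head. rewrite EP in E1.
      symmetry in E1. now apply Permutation_cons_app_inv in E1.
    + now apply PF2_app.
Qed.

(** A reduction inside a pair is the instance of [Rep_leaf] where the pair leaves its reduct and
    contributes [Some []]; the reduct then moves back to its place by a permutation. *)
Lemma Rep_leaf_ctx f g b th mu D1 a p a' p' D2 c B m :
  Rep f g (Mtc b th mu (D1 ++ (a, p) :: D2)) (TMtc c B m) ->
  (forall A, Rep f g a A -> exists A', par bt A A' /\ Rep f g a' A') ->
  (forall P, Rep f (psh th g) p P -> exists P', par bt P P' /\ Rep f (psh th g) p' P') ->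
  exists e, par bt (TMtc c B m) e /\ Rep f g (Mtc b th mu (D1 ++ (a', p') :: D2)) e.
Proof.
  intros HR Ha Hp. destruct (Rep_leaf f g b th mu D1 a p D2 c B m [(a', p')] (Some []) HR) as (m' & P' & R').
  - intros A P (_ & HA & HP). destruct (Ha _ HA) as (A' & PA & RA), (Hp _ HP) as (P' & PP & RP).
    exists (TPend (length th) A' P'). split; [now constructor|]. split; [reflexivity|]. split.
    + exists [], (length th, A', P'), []. repeat split; auto.
    + now apply RepMu_nil.
  - exists (TMtc c B m'). split; auto. rewrite dunion_nil in R'.
    refine (proj1 (Rep_tequiv _ _ (tequiv_base _ _ (eq_perm_D b th mu _ _ _)) f g _) R').
    exact (Permutation_middle D1 D2 (a', p')).
Qed.

Lemma Rep_rule t u : rule bot t u -> forall f g d, inj f -> inj g -> Rep f g t d ->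
  exists e, par bt d e /\ Rep f g u e.
Proof.
  destruct 1; intros f g d Hf Hg HR; inv_rep HR.
  - destruct HR as [HR Ha]. inv_rep HR. destruct HR as (-> & Hp & Hb).
    exists (TMtc (map (idx th) th) d1_2 (TPend (length (map (idx th) th)) d2 d1_1)). split.
    + apply p_beta; apply par_refl.
    + apply Rep_mtc. rewrite length_map. repeat split; auto.
      * now apply RepMu_nil.
      * exists [], (length th, d2, d1_1), []. repeat split; auto.
  - destruct HR as [HR Ha]. inv_rep HR. exists (TDat (TM i) d2). split; [|split; auto].
    constructor. apply par_refl.
  - destruct HR as [HR Ha]. inv_rep HR. exists (TDat (TDat d1_1 d1_2) d2). split; [|split; auto].
    constructor; apply par_refl.
  - edestruct (Rep_leaf f g b th mu [] a (Mat x) D c d1 d2 [] (Some [(x, a)]) HR) as (m' & P' & R'); eauto.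
    intros A P (_ & HA & HP). simpl in HA, HP. destruct P; try contradiction. subst i.
    destruct (psh_in th g id x H) as [Hl E].
    exists (TBnd (psh th g x) A). split; [constructor; auto; apply par_refl|]. split; [reflexivity|].
    split; [reflexivity|]. split.
    + intros [E'|E']; [discriminate|]. apply E'. repeat constructor; auto.
    + exists [], (psh th g x, A), []. repeat split; auto.
  - edestruct (Rep_leaf f g b th mu [] (Mat x) (Mat x) D c d1 d2 [] (Some []) HR) as (m' & P' & R').
    + intros A P (_ & HA & HP). simpl in HA, HP. destruct A, P; try contradiction. subst.
      exists TOk. rewrite psh_notin by assumption. split; [constructor|]. repeat split.
      now apply RepMu_nil.
    + exists (TMtc c d1 m'). split; auto. now rewrite dunion_nil in R'.
  - edestruct (Rep_leaf f g b th mu [] (Dat a1 a2) (Dat p1 p2) D c d1 d2 [(a1, p1); (a2, p2)] (Some []) HR)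
      as (m' & P' & R').
    + intros A P (_ & HA & HP). simpl in HA, HP. destruct A, P; try contradiction. destruct HA, HP.
      exists (TNode (TPend (length th) A1 P1) (TPend (length th) A2 P2)). split; [constructor; apply par_refl|].
      split; [reflexivity|]. split.
      * simpl. exists [], (length th, A1, P1), [(length th, A2, P2)]. repeat split; auto.
        exists [], (length th, A2, P2), []. repeat split; auto.
      * now apply RepMu_nil.
    + exists (TMtc c d1 m'). split; auto. now rewrite dunion_nil in R'.
  - edestruct (Rep_leaf f g b th mu [] a p D c d1 d2 [] None HR) as (m' & P' & R').
    + intros A P HAP. exists TFail. repeat split.
      * constructor. eapply failure_failb; eauto.
      * now left.
    + exists (TMtc c d1 m'). split; auto. destruct mu; exact R'.
  - apply Rep_mtc in HR as (-> & Hb & W & (HM & HS) & HD). simpl in HD.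
    exists (sub (inst (length (map (idx th) th)) (binds d2)) id d1). split.
    + apply p_sub; auto using par_refl. apply (same_set_idx th (map fst s)); auto.
      eapply PF2_keys; eauto.
    + rewrite length_map. eapply Rep_inst; eauto.
      destruct (NoDup_dec Nat.eq_dec (keys d2)); auto. destruct HM. now right.
  - apply Rep_mtc in HR as (-> & Hb & W & (HM & HS) & HD). simpl in HD.
    exists bt. split; auto. apply p_dom; auto. intros HE. apply H.
    apply (same_set_idx th (map fst s) (keys d2)); auto. eapply PF2_keys; eauto.
  - apply Rep_mtc in HR as (-> & Hb & W & HM & HD). exists bt. split; auto. now apply p_bot.
Qed.

Lemma Rep_ctx_rule t u : ctx (rule bot) t u -> forall f g d, inj f -> inj g -> Rep f g t d ->
  exists e, par bt d e /\ Rep f g u e.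
Proof.
  induction 1; intros f g d Hf Hg HR; [eapply Rep_rule; eauto|inv_rep HR..].
  - destruct HR as [H1 H2]. destruct (IHctx _ _ _ Hf Hg H1) as (e & P & R).
    exists (TApp e d2). split; [constructor; auto using par_refl|now split].
  - destruct HR as [H1 H2]. destruct (IHctx _ _ _ Hf Hg H2) as (e & P & R).
    exists (TApp d1 e). split; [constructor; auto using par_refl|now split].
  - destruct HR as [H1 H2]. destruct (IHctx _ _ _ Hf Hg H1) as (e & P & R).
    exists (TDat e d2). split; [constructor; auto using par_refl|now split].
  - destruct HR as [H1 H2]. destruct (IHctx _ _ _ Hf Hg H2) as (e & P & R).
    exists (TDat d1 e). split; [constructor; auto using par_refl|now split].
  - destruct HR as (Hc & Hp & Hb). destruct (IHctx _ _ _ Hf (psh_inj th g Hg) Hp) as (e & P & R).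
    exists (TAbs c e d2). split; [constructor; auto using par_refl|now split].
  - destruct HR as (Hc & Hp & Hb). destruct (IHctx _ _ _ (psh_inj th f Hf) Hg Hb) as (e & P & R).
    exists (TAbs c d1 e). split; [constructor; auto using par_refl|now split].
  - apply Rep_mtc in HR as (Hc & Hb & HR). destruct (IHctx _ _ _ (psh_inj th f Hf) Hg Hb) as (e & P & R).
    exists (TMtc c e d2). split; [constructor; auto using par_refl|]. apply Rep_mtc. auto.
  - apply Rep_mtc in HR as (Hc & Hb & W & (HM & HS) & HD).
    apply PF2_mid in HS as (S1 & [k A] & S2 & ES & (Ek & HA) & HS).
    destruct (IHctx _ _ _ Hf Hg HA) as (A' & PA & RA).
    destruct (par_bind_in d2 k A A') as (m' & R & P' & W' & E1 & E2 & E3 & E4); auto.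
    { rewrite ES. apply in_elt. }
    exists (TMtc c d1 m'). split; [constructor; auto using par_refl|].
    apply Rep_mtc. split; [|split; [|split; [|split]]]; auto.
    + assert (EK : Permutation (keys m') (keys d2)) by (unfold keys; now rewrite E3, E4).
      split.
      * intros [F|F]; apply HM; [left; congruence|right]. intros N. apply F. eapply Permutation_NoDup; [symmetry; exact EK|exact N].
      * apply (PF2_perm _ ((x, a') :: s1 ++ s2) _ ((k, A') :: R) _);
          [apply Permutation_middle|now symmetry|].
        exists [], (k, A'), R. repeat split; auto. eapply PF2_perm; [reflexivity| |exact HS].
        rewrite ES in E3. symmetry in E3. symmetry. now apply Permutation_cons_app_inv in E3.
    + now rewrite E1.
  - eapply Rep_leaf_ctx; eauto. intros P HP. exists P. split; auto using par_refl.
  - eapply Rep_leaf_ctx; eauto using psh_inj. intros A HA. exists A. split; auto using par_refl.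
Qed.

Lemma Rep_steps t u : steps bot t u -> forall f g d, inj f -> inj g -> Rep f g t d ->
  exists e, clos_refl_trans _ (par bt) d e /\ Rep f g u e.
Proof.
  induction 1 as [t u (t' & u' & E1 & S & E2)|t|t u v _ IH1 _ IH2]; intros f g d Hf Hg HR.
  - apply (Rep_tequiv _ _ E1) in HR. destruct (Rep_ctx_rule _ _ S f g d Hf Hg HR) as (e & P & R).
    exists e. split; [now apply rt_step|]. now apply (Rep_tequiv _ _ E2).
  - exists d. split; auto. apply rt_refl.
  - destruct (IH1 f g d Hf Hg HR) as (e & P1 & R1), (IH2 f g e Hf Hg R1) as (e' & P2 & R2).
    exists e'. split; auto. eapply rt_trans; eauto.
Qed.

(** * From parallel steps to named reductions *)

Definition red : term -> term -> Prop := clos_refl_trans _ (fun t u => step bot t u \/ tequiv t u).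

Lemma red_refl t : red t t.
Proof. apply rt_refl. Qed.

Lemma red_trans t u v : red t u -> red u v -> red t v.
Proof. apply rt_trans. Qed.

Lemma red_tequiv t u : tequiv t u -> red t u.
Proof. intros. apply rt_step. auto. Qed.

Lemma red_rule t u : rule bot t u -> red t u.
Proof.
  intros H. apply rt_step. left. exists t, u. split; [apply tequiv_refl|]. split; [now constructor|apply tequiv_refl].
Qed.

Lemma red_compat C t u : compat C -> red t u -> red (C t) (C u).
Proof.
  intros HC. induction 1 as [t u [(t' & u' & E1 & S & E2)|E]|t|t u v _ IH1 _ IH2].
  - apply rt_step. left. exists (C t'), (C u').
    split; [now apply tequiv_compat|]. split; [now apply HC|now apply tequiv_compat].
  - apply red_tequiv. now apply tequiv_compat.
  - apply red_refl.
  - eapply red_trans; eauto.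
Qed.

(** A step absorbs the equivalences before it, since [step] is closed under [tequiv]; only those
    after the last step are left over. *)
Lemma red_steps t u : red t u -> exists u', steps bot t u' /\ tequiv u' u.
Proof.
  intros H. apply clos_rt_rtn1_iff in H. induction H as [|u v [S|E] _ (u' & Hs & E')].
  - exists t. split; [apply rt_refl|apply tequiv_refl].
  - exists v. split; [|apply tequiv_refl]. eapply rt_trans; [exact Hs|]. apply rt_step.
    destruct S as (u1 & v1 & E1 & S & E2). exists u1, v1. split; auto. eapply tequiv_trans; eauto.
  - exists u'. split; auto. eapply tequiv_trans; eauto.
Qed.

Lemma red_app t t' u u' : red t t' -> red u u' -> red (App t u) (App t' u').
Proof.
  intros Ht Hu. eapply red_trans; [exact (red_compat _ _ _ (compat_app_l u) Ht)
                                  |exact (red_compat _ _ _ (compat_app_r t') Hu)].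
Qed.

Lemma red_dat t t' u u' : red t t' -> red u u' -> red (Dat t u) (Dat t' u').
Proof.
  intros Ht Hu. eapply red_trans; [exact (red_compat _ _ _ (compat_dat_l u) Ht)
                                  |exact (red_compat _ _ _ (compat_dat_r t') Hu)].
Qed.

Lemma red_abs th p p' b b' : red p p' -> red b b' -> red (Abs th p b) (Abs th p' b').
Proof.
  intros Hp Hb. eapply red_trans; [exact (red_compat _ _ _ (compat_abs_p th b) Hp)
                                  |exact (red_compat _ _ _ (compat_abs_b th p') Hb)].
Qed.

Lemma red_pair b th mu a a' p p' D : red a a' -> red p p' ->
  red (Mtc b th mu ((a, p) :: D)) (Mtc b th mu ((a', p') :: D)).
Proof.
  intros Ha Hp. eapply red_trans; [exact (red_compat _ _ _ (compat_mtc_D1 b th mu [] p D) Ha)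
                                  |exact (red_compat _ _ _ (compat_mtc_D2 b th mu [] a' D) Hp)].
Qed.

Lemma red_perm_D b th mu D D' : Permutation D D' -> red (Mtc b th mu D) (Mtc b th mu D').
Proof. intros. now apply red_tequiv, tequiv_base, eq_perm_D. Qed.

Lemma red_perm_mu b th s s' D : Permutation s s' -> red (Mtc b th (Some s) D) (Mtc b th (Some s') D).
Proof. intros. now apply red_tequiv, tequiv_base, eq_perm_mu. Qed.

Definition SimT (d d' : tm) : Prop := forall f g t, inj f -> inj g -> Rep f g t d ->
  exists u, red t u /\ Rep f g u d'.

(* [o] is what the pairs resolved between [m] and [m'] contribute to the decided match. *)
Definition SimM (m m' : tm) : Prop := forall th f g D, inj f -> inj g -> wsm m = true ->
  PF2 (RepP th f g) D (pend m) ->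
  exists D' o, PF2 (RepP th f g) D' (pend m') /\
    (forall b mu D0, red (Mtc b th mu (D ++ D0)) (Mtc b th (dunion mu o) (D' ++ D0))) /\
    match o with
    | None => failing m'
    | Some s1 => fl m' = fl m /\ NoDup (map fst s1) /\ incl (map (idx th) (map fst s1)) (keys m') /\
        forall s, PF2 (RepB th f g) s (binds m) ->
          exists s2, PF2 (RepB th f g) (s2 ++ s1) (binds m') /\ Permutation (map fst s2) (map fst s) /\
            forall b s0 D, red (Mtc b th (Some (s ++ s0)) D) (Mtc b th (Some (s2 ++ s0)) D)
    end.

(** A pending leaf has no old bindings to follow, so [RepMu] of the new tree already contains the
    clauses on keys and failure. *)
Lemma SimM_leaf m m' n A P : pend m = [(n, A, P)] -> binds m = [] -> fl m = false ->
  (forall th f g a p, inj f -> inj g -> RepP th f g (a, p) (n, A, P) -> exists D' o,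
     PF2 (RepP th f g) D' (pend m') /\
     (forall b mu D0, red (Mtc b th mu ((a, p) :: D0)) (Mtc b th (dunion mu o) (D' ++ D0))) /\
     RepMu th f g o m') ->
  SimM m m'.
Proof.
  intros Ep Eb Ef H th f g D Hf Hg _ HD. rewrite Ep in HD. apply PF2_single in HD as ([a p] & -> & HR).
  destruct (H th f g a p Hf Hg HR) as (D' & o & HD' & Hred & HM). exists D', o. split; [|split]; auto.
  destruct o as [s1|]; auto. destruct HM as [HM HS]. pose proof (PF2_keys _ _ _ _ _ HS) as K.
  split; [|split; [|split]].
  - rewrite Ef. destruct (fl m') eqn:E; auto. destruct HM. now left.
  - apply (NoDup_idx th). apply (Permutation_NoDup (Permutation_sym K)).
    destruct (NoDup_dec Nat.eq_dec (keys m')); auto. destruct HM. now right.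
  - intros k Hk. eapply Permutation_in; eauto.
  - intros s Hs. rewrite Eb in Hs. apply PF2_nil_r in Hs as ->. exists []. repeat split; auto.
    intros. apply red_refl.
Qed.

(** The halves are resolved one after the other, each with the pairs of the other in the frame [D0],
    and associativity merges the contributions. If these clash, the inclusion of keys puts the
    shared key into both subtrees, so the node is failing. *)
Lemma SimM_node m1 m1' m2 m2' : SimM m1 m1' -> SimM m2 m2' -> SimM (TNode m1 m2) (TNode m1' m2').
Proof.
  intros H1 H2 th f g D Hf Hg W HD. simpl in W. apply andb_prop in W as [W1 W2]. simpl in HD.
  apply PF2_app_l in HD as (D1 & D2 & PD & HD1 & HD2).
  destruct (H1 th f g D1 Hf Hg W1 HD1) as (D1' & o1 & R1 & S1 & O1).
  destruct (H2 th f g D2 Hf Hg W2 HD2) as (D2' & o2 & R2 & S2 & O2).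
  pose proof (failing_union m1' m2' (TNode m1' m2') eq_refl (Permutation_refl _)) as HF.
  exists (D1' ++ D2'), (dunion o1 o2). split; [|split].
  - now apply PF2_app.
  - intros b mu D0. eapply red_trans; [apply red_perm_D|].
    { rewrite PD, <- app_assoc. reflexivity. }
    eapply red_trans; [apply S1|]. eapply red_trans; [apply red_perm_D|].
    { rewrite app_assoc, (Permutation_app_comm D1' D2), <- app_assoc. reflexivity. }
    eapply red_trans; [apply S2|]. rewrite dunion_assoc. apply red_perm_D.
    rewrite !app_assoc. apply Permutation_app_tail, Permutation_app_comm.
  - destruct o1 as [s1|]; [|apply HF; auto]. destruct o2 as [s2|]; [|apply HF; auto].
    destruct O1 as (F1 & N1 & I1 & B1), O2 as (F2 & N2 & I2 & B2).
    destruct (dunion_some s1 s2) as [[-> Hd]|[-> (x & X1 & X2)]].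
    + split; [|split; [|split]].
      * simpl. congruence.
      * rewrite map_app. apply NoDup_app_iff. auto.
      * rewrite !map_app. unfold keys. simpl. rewrite map_app. apply incl_app_app; auto.
      * intros s Hs. simpl in Hs. apply PF2_app_l in Hs as (sa & sb & Ps & Hsa & Hsb).
        destruct (B1 sa Hsa) as (sa' & Ra & Ka & Sa), (B2 sb Hsb) as (sb' & Rb & Kb & Sb).
        exists (sa' ++ sb'). split; [|split].
        -- eapply PF2_perm; [|reflexivity|exact (PF2_app _ _ _ _ _ Ra Rb)].
           rewrite <- !app_assoc. apply Permutation_app_head. rewrite !app_assoc.
           apply Permutation_app_tail, Permutation_app_comm.
        -- rewrite (Permutation_map fst Ps), !map_app. now apply Permutation_app.
        -- intros b s0 D0. eapply red_trans; [apply red_perm_mu|].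
           { rewrite Ps, <- app_assoc. reflexivity. }
           eapply red_trans; [apply Sa|]. eapply red_trans; [apply red_perm_mu|].
           { rewrite app_assoc, (Permutation_app_comm sa' sb), <- app_assoc. reflexivity. }
           eapply red_trans; [apply Sb|]. apply red_perm_mu.
           rewrite !app_assoc. apply Permutation_app_tail, Permutation_app_comm.
    + apply HF. right; right. exists (idx th x). split; [apply I1|apply I2]; now apply in_map.
Qed.

(** The old bindings are reduced first, from [s] to [s2], and then the pairs are resolved. As [s2]
    and [s1] each have distinct keys, their union is bottom exactly when a key of [m'] repeats. *)
Lemma SimT_mtc c b b' m m' : par bt m m' -> SimT b b' -> SimM m m' -> SimT (TMtc c b m) (TMtc c b' m').
Proof.
  intros HP Hb Hm f g t Hf Hg HR. inv_rep HR. apply Rep_mtc in HR as (Hc & Rb & W & HM & HD).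
  destruct (Hb _ _ _ (psh_inj th f Hf) Hg Rb) as (u & Su & Ru).
  destruct (par_wsm _ _ _ HP W) as (W' & _).
  destruct (Hm th f g D Hf Hg W HD) as (D' & o & HD' & SD & O).
  assert (Hmu : exists mu', red (Mtc u th mu D) (Mtc u th mu' D') /\ RepMu th f g mu' m').
  { specialize (SD u). destruct mu as [s|].
    - destruct HM as [NF HS]. destruct o as [s1|].
      + destruct O as (Ff & N1 & _ & B). destruct (B s HS) as (s2 & R2 & K2 & S2).
        exists (dunion (Some s2) (Some s1)). split.
        * specialize (S2 u [] D). specialize (SD (Some s2) []). rewrite !app_nil_r in *.
          eapply red_trans; eauto.
        * assert (Nk : NoDup (keys m') <-> forall x, In x (map fst s2) -> ~ In x (map fst s1)).
          { rewrite (PF2_NoDup th f g (s2 ++ s1) (binds m')) by exact R2.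
            rewrite map_app, NoDup_app_iff. split; [tauto|]. intros Hx. split; [|split]; auto.
            eapply Permutation_NoDup; [symmetry; exact K2|].
            apply (PF2_NoDup th f g s (binds m) HS).
            destruct (NoDup_dec Nat.eq_dec (keys m)); auto. destruct NF. now right. }
          destruct (dunion_some s2 s1) as [[-> Hd]|[-> (x & X1 & X2)]].
          -- split; auto. intros [E|E]; [|tauto]. apply NF. left. congruence.
          -- right. rewrite Nk. intros Hx. now apply (Hx x).
      + exists None. split; auto. specialize (SD (Some s) []). now rewrite !app_nil_r in SD.
    - exists None. split; [|eapply failing_par; eauto]. specialize (SD None []). now rewrite !app_nil_r in SD. }
  destruct Hmu as (mu' & Sm & RM). exists (Mtc u th mu' D'). split.
  - eapply red_trans; [exact (red_compat _ _ _ (compat_mtc_b th mu D) Su)|exact Sm].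
  - apply Rep_mtc. auto.
Qed.

(** The contraction alone, on a fully resolved matching. The body is first converted to one without
    capture. *)
Lemma SimT_sub c B m f g t : Rep f g t (TMtc c B m) -> pend m = [] -> ~ failing m -> same_set (keys m) c ->
  exists u, red t u /\ Rep f g u (sub (inst (length c) (binds m)) id B).
Proof.
  intros HR Ep NF HS. inv_rep HR. apply Rep_mtc in HR as (-> & Rb & W & HM & HD).
  rewrite Ep in HD. apply PF2_nil_r in HD as ->. destruct mu as [s|]; [|contradiction]. destruct HM as [_ HM].
  destruct (avoid_bnames (flat_map fn (map snd s)) t) as (b' & Eb & Hc).
  assert (Hs : same_set (map fst s) th)
    by (apply (same_set_idx th _ _ (PF2_keys _ _ _ _ _ HM)); exact HS).
  exists (subst s b'). split.
  - eapply red_trans; [apply red_tequiv, (tequiv_compat _ _ _ (compat_mtc_b th (Some s) []) Eb)|].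
    apply red_rule, r_subst; auto.
  - rewrite length_map. apply (Rep_inst b' th f g); auto.
    + now apply (Rep_tequiv _ _ Eb).
    + destruct (NoDup_dec Nat.eq_dec (keys m)); auto. destruct NF. now right.
Qed.

(** Terms and match trees contain each other, so both simulations run in one induction. For each
    source constructor one of them is vacuous: terms are not [wsm], and match trees represent no
    named term. *)
Lemma par_sim d d' : par bt d d' -> SimT d d' /\ SimM d d'.
Proof.
  induction 1; split; try (intros th f g D Hf Hg W; discriminate W);
    try (intros f g t0 Hf Hg HR; inv_rep HR; fail).
  - intros f g t Hf Hg HR. exists t. split; auto using red_refl.
  - intros f g t Hf Hg HR. exists t. split; auto using red_refl.
  - intros f g v Hf Hg HR. inv_rep HR. destruct HR as [H1 H2], IHpar1 as [T1 _], IHpar2 as [T2 _].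
    destruct (T1 _ _ _ Hf Hg H1) as (w1 & S1 & R1), (T2 _ _ _ Hf Hg H2) as (w2 & S2 & R2).
    exists (App w1 w2). split; [now apply red_app|now split].
  - intros f g v Hf Hg HR. inv_rep HR. destruct HR as [H1 H2], IHpar1 as [T1 _], IHpar2 as [T2 _].
    destruct (T1 _ _ _ Hf Hg H1) as (w1 & S1 & R1), (T2 _ _ _ Hf Hg H2) as (w2 & S2 & R2).
    exists (Dat w1 w2). split; [now apply red_dat|now split].
  - intros f g v Hf Hg HR. inv_rep HR. destruct HR as (Hc & H1 & H2), IHpar1 as [T1 _], IHpar2 as [T2 _].
    destruct (T1 _ _ _ Hf (psh_inj th g Hg) H1) as (w1 & S1 & R1).
    destruct (T2 _ _ _ (psh_inj th f Hf) Hg H2) as (w2 & S2 & R2).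
    exists (Abs th w1 w2). split; [now apply red_abs|now split].
  - apply SimT_mtc; tauto.
  - apply (SimM_leaf _ _ n a p); auto. intros th f g a0 p0 Hf Hg (En & HA & HP). simpl in *. subst n.
    destruct IHpar1 as [T1 _], IHpar2 as [T2 _].
    destruct (T1 _ _ _ Hf Hg HA) as (a1 & Sa & Ra), (T2 _ _ _ Hf (psh_inj th g Hg) HP) as (p1 & Sp & Rp).
    exists [(a1, p1)], (Some []). split; [|split].
    + exists [], (length th, a', p'), []. repeat split; auto.
    + intros. rewrite dunion_nil. now apply red_pair.
    + now apply RepMu_nil.
  - intros th f g D Hf Hg _ HD. simpl in HD. apply PF2_nil_r in HD as ->. destruct IHpar as [T _].
    exists [], (Some []). split; [reflexivity|]. split; [intros; rewrite dunion_nil; apply red_refl|].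
    split; [reflexivity|]. split; [constructor|]. split; [intros x []|]. intros s Hs.
    apply PF2_single in Hs as ([x a0] & -> & Ek & HA). simpl in *.
    destruct (T _ _ _ Hf Hg HA) as (a1 & Sa & Ra). exists [(x, a1)]. split; [|split]; auto.
    + exists [], (k, a'), []. repeat split; auto.
    + intros b s0 D. exact (red_compat _ _ _ (compat_mtc_mu b th [] x s0 D) Sa).
  - intros th f g D Hf Hg _ HD. simpl in HD. apply PF2_nil_r in HD as ->.
    exists [], (Some []). split; [reflexivity|]. split; [intros; rewrite dunion_nil; apply red_refl|].
    split; [reflexivity|]. split; [constructor|]. split; [intros x []|]. intros s Hs. apply PF2_nil_r in Hs as ->.
    exists []. split; [reflexivity|]. split; auto. intros; apply red_refl.
  - intros th f g D Hf Hg _ HD. simpl in HD. apply PF2_nil_r in HD as ->.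
    exists [], (Some []). split; [reflexivity|]. split; [intros; rewrite dunion_nil; apply red_refl|].
    split; [reflexivity|]. split; [constructor|]. split; [intros x []|]. intros s Hs. apply PF2_nil_r in Hs as ->.
    exists []. split; [reflexivity|]. split; auto. intros; apply red_refl.
  - apply SimM_node; tauto.
  - intros f g v Hf Hg HR. inv_rep HR. destruct HR as [HR Ha]. inv_rep HR. destruct HR as (-> & Hp & Hb).
    destruct IHpar1 as [T1 _], IHpar2 as [T2 _], IHpar3 as [T3 _].
    destruct (T1 _ _ _ Hf (psh_inj th g Hg) Hp) as (w1 & S1 & R1).
    destruct (T2 _ _ _ (psh_inj th f Hf) Hg Hb) as (w2 & S2 & R2).
    destruct (T3 _ _ _ Hf Hg Ha) as (w3 & S3 & R3).
    exists (Mtc w2 th (Some []) [(w3, w1)]). split.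
    + eapply red_trans; [|apply red_rule, r_beta]. apply red_app; auto. now apply red_abs.
    + apply Rep_mtc. rewrite length_map. repeat split; auto.
      * now apply RepMu_nil.
      * exists [], (length th, a', p'), []. repeat split; auto.
  - intros f g v Hf Hg HR. inv_rep HR. destruct HR as [HR Ha]. inv_rep HR. destruct IHpar as [T _].
    destruct (T _ _ _ Hf Hg Ha) as (w3 & S3 & R3). exists (Dat (Mat x) w3). split; [|now split].
    eapply red_trans; [|apply red_rule, r_mat]. apply red_app; auto using red_refl.
  - intros f g v Hf Hg HR. inv_rep HR. destruct HR as [HR Ha]. inv_rep HR. destruct HR as [Hb Hc].
    destruct IHpar1 as [T1 _], IHpar2 as [T2 _], IHpar3 as [T3 _].
    destruct (T1 _ _ _ Hf Hg Hb) as (w1 & S1 & R1).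
    destruct (T2 _ _ _ Hf Hg Hc) as (w2 & S2 & R2).
    destruct (T3 _ _ _ Hf Hg Ha) as (w3 & S3 & R3). exists (Dat (Dat w1 w2) w3). split; [|now repeat split].
    eapply red_trans; [|apply red_rule, r_dat].
    apply red_app; auto. now apply red_dat.
  - apply (SimM_leaf _ _ n a (TM k)); auto. intros th f g a0 p0 Hf Hg (En & HA & HP). simpl in *. subst n.
    inv_rep HP. simpl in HP. subst k. apply psh_lt in H. destruct IHpar as [T _].
    destruct (T _ _ _ Hf Hg HA) as (a1 & Sa & Ra). destruct (psh_in th g id x H) as [_ E].
    exists [], (Some [(x, a1)]). split; [reflexivity|]. split.
    + intros. eapply red_trans; [apply red_pair; [exact Sa|apply red_refl]|].
      apply rt_step. left. now apply step_bind.
    + split.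
      * intros [E'|E']; [discriminate|]. apply E'. repeat constructor; auto.
      * exists [], (psh th g x, a'), []. repeat split; auto.
  - apply (SimM_leaf _ _ n (TM i) (TM (n + i))); auto. intros th f g a0 p0 Hf Hg (En & HA & HP).
    simpl in *. subst n. inv_rep HA. inv_rep HP. simpl in *.
    assert (Hx : ~ In x0 th) by (intros Hx; apply (psh_lt th g) in Hx; lia).
    rewrite psh_notin in HP by assumption. assert (x0 = x) as -> by (apply Hg; lia).
    exists [], (Some []). split; [reflexivity|]. split.
    + intros. rewrite dunion_nil. now apply red_rule, r_same.
    + now apply RepMu_nil.
  - apply (SimM_leaf _ _ n (TDat a1 a2) (TDat p1 p2)); auto. intros th f g a0 p0 Hf Hg (En & HA & HP).
    simpl in *. subst n. inv_rep HA. inv_rep HP. destruct HA as [HA1 HA2], HP as [HP1 HP2].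
    destruct IHpar1 as [T1 _], IHpar2 as [T2 _], IHpar3 as [T3 _], IHpar4 as [T4 _].
    destruct (T1 _ _ _ Hf Hg HA1) as (w1 & S1 & R1), (T2 _ _ _ Hf Hg HA2) as (w2 & S2 & R2).
    destruct (T3 _ _ _ Hf (psh_inj th g Hg) HP1) as (w3 & S3 & R3).
    destruct (T4 _ _ _ Hf (psh_inj th g Hg) HP2) as (w4 & S4 & R4).
    exists [(w1, w3); (w2, w4)], (Some []). split; [|split].
    + simpl. exists [], (length th, a1', p1'), [(length th, a2', p2')]. repeat split; auto.
      exists [], (length th, a2', p2'), []. repeat split; auto.
    + intros. rewrite dunion_nil. eapply red_trans; [|apply red_rule, r_split].
      apply red_pair; now apply red_dat.
    + now apply RepMu_nil.
  - apply (SimM_leaf _ _ n a p); auto. intros th f g a0 p0 Hf Hg HAP.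
    pose proof (proj1 HAP) as En. simpl in En. subst n.
    exists [], None. split; [reflexivity|]. split; [|now left].
    intros. replace (dunion mu None) with (@None (list (name * term))) by now destruct mu.
    apply red_rule, r_fail. eapply failb_failure; eauto.
  - intros f g t Hf Hg HR.
    (* The inner steps come first and the contraction last; the latter is still allowed since
       without pending pairs the reduct [m'] has the same keys and failures as [m]. *)
    destruct (SimT_mtc c b b' m m') with (f := f) (g := g) (t := t) as (u & S & R); auto; try tauto.
    destruct (par_wsm _ _ _ H4 H) as (_ & _ & _ & Hp). destruct (Hp H0) as (P' & F' & B').
    assert (Ek : keys m' = keys m) by (symmetry; eapply Forall2_keys; exact B').
    destruct (SimT_sub c b' m' f g u R P') as (u' & S' & R').
    + now rewrite (failing_map m).
    + now rewrite Ek.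
    + exists u'. split; auto. eapply red_trans; eauto.
  - intros f g t Hf Hg HR. inv_rep HR. apply Rep_mtc in HR as (-> & Rb & W & HM & HD).
    rewrite H0 in HD. apply PF2_nil_r in HD as ->. destruct mu as [s|]; [|contradiction]. destruct HM as [_ HM].
    exists bot. split; auto. apply red_rule, r_dom. intros Hs. apply H2.
    apply (same_set_idx th _ _ (PF2_keys _ _ _ _ _ HM)); exact Hs.
  - intros f g t Hf Hg HR. inv_rep HR. apply Rep_mtc in HR as (-> & Rb & W & HM & HD).
    destruct mu as [s|]; [destruct HM; contradiction|]. exists bot. split; auto. apply red_rule, r_bot.
Qed.

Lemma par_rt_sim d e : clos_refl_trans _ (par bt) d e -> SimT d e.
Proof.
  induction 1 as [d e P|d|d e h _ IH1 _ IH2]; intros f g t Hf Hg HR.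
  - now apply (par_sim d e P).
  - exists t. split; auto using red_refl.
  - destruct (IH1 f g t Hf Hg HR) as (u & S1 & R1), (IH2 f g u Hf Hg R1) as (v & S2 & R2).
    exists v. split; auto. eapply red_trans; eauto.
Qed.

End Simulation.

Theorem theorem2 (bot : term) :
  bot_ok bot ->
  forall a b c, wf a -> steps bot a b -> steps bot a c ->
    exists d d', steps bot b d /\ steps bot c d' /\ tequiv d d'.
Proof.
  intros (Hfn & Hp & _) a b c Hw Hb Hc. apply app_eq_nil in Hfn as [Hfv Hfm].
  set (bt := enc id id bot).
  assert (Hcl : forall s q, sub s q bt = bt).
  { intros s q. apply sub_enc; auto; [rewrite Hfv|rewrite Hfm]; intros x []. }
  (* Bottom has no free names, so the tree computed for [id] is right for every assignment. *)
  assert (Hrep : forall f g, Rep f g bot bt).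
  { intros f g. eapply Rep_ext; [now apply Rep_enc|rewrite Hfv|rewrite Hfm]; intros x []. }
  assert (Hid : inj id) by now intros x y.
  destruct (Rep_exists a Hw id id) as [A HA].
  destruct (Rep_steps bot bt Hrep a b Hb id id A Hid Hid HA) as (B & PB & RB).
  destruct (Rep_steps bot bt Hrep a c Hc id id A Hid Hid HA) as (C & PC & RC).
  destruct (par_confluent bt Hcl A B C PB PC) as (E & PBE & PCE).
  destruct (par_rt_sim bot bt Hrep B E PBE id id b Hid Hid RB) as (d0 & Sd & Rd).
  destruct (par_rt_sim bot bt Hrep C E PCE id id c Hid Hid RC) as (d0' & Sd' & Rd').
  destruct (red_steps bot b d0 Sd) as (d & Hd & Ed), (red_steps bot c d0' Sd') as (d' & Hd' & Ed').
  exists d, d'. split; [|split]; auto.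
  (* The two named reducts are represented by the same tree [E], so they are equivalent; the
     trailing equivalences left by [red_steps] are added on either side. *)
  eapply tequiv_trans; [exact Ed|]. eapply tequiv_trans; [|apply tequiv_sym; exact Ed'].
  now apply (Rep_reflects E id id).
Qed.
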